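(* Let $G$ be a noncomplete decomposable graph and let $P=(C_1,\dots,C_k)$ be a perfect order of its cliques. Then $B_P\subset\mathcal{B}$. More specifically, for $\theta\in Q_G$ and $(\alpha,\beta)\in B_P$ the integral below converges and $$\int_{P_G}e^{-\langle\theta,y\rangle}H_G(\alpha,\beta;\varphi(y))\,\nu_G(dy)=\Gamma_{\mathrm{II}}(\alpha,\beta)\,H_G(\alpha,\beta;\theta),$$ where $$\Gamma_{\mathrm{II}}(\alpha,\beta)=\Gamma_{s_2}\Big[-\alpha_1-\frac{c_1-s_2}{2}-\gamma_2\Big]\,\frac{\Gamma_{c_1}(-\alpha_1)}{\Gamma_{s_2}\big(-\alpha_1-\frac{c_1-s_2}{2}\big)}\prod_{j=2}^k\frac{\Gamma_{c_j}(-\alpha_j)}{\Gamma_{s_j}\big(-\alpha_j-\frac{c_j-s_j}{2}\big)}.$$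
   Context: **Graphs.** $G=(V,E)$ is an undirected graph with $V=\{1,\dots,r\}$; $E\subset V\times V$ is symmetric and contains all $(i,i)$. $G$ is decomposable if it is connected and has no induced cycle of length $\ge4$. A clique is a maximal complete subset of $V$; $\mathcal{C}$ is the set of cliques. A perfect order of the cliques is an order $P=(C_1,\dots,C_k)$ such that, with $S_j=(C_1\cup\dots\cup C_{j-1})\cap C_j$, for each $j\ge2$ there is $i<j$ with $S_j\subset C_i$. The sets $S_2,\dots,S_k$ are the minimal separators; $\mathcal{S}$ is the set of distinct ones and $\nu(S)$, the number of $j$ with $S_j=S$, does not depend on the perfect order. **Cones.** $I_G$ is the real space of functions $x:E\to\mathbb{R}$ with $x_{ij}=x_{ji}$; $Z_G$ is the space of symmetric $r\times r$ matrices $y$ with $y_{ij}=0$ for $(i,j)\notin E$. $P_G=\{y\in Z_G: y \text{ positive definite}\}$; $Q_G=\{x\in I_G: x_C \text{ positive definite for every clique } C\}$, where $x_C=(x_{ij})_{i,j\in C}$. For $x\in Q_G$ there is a unique positive definite $\hat x$ with $\hat x_{ij}=x_{ij}$ for $(i,j)\in E$ and $\hat x^{-1}\in P_G$; $x\mapsto\hat x^{-1}$ is a bijection $Q_G\to P_G$ with inverse $\varphi$ ($\varphi(y)$ is the restriction of $y^{-1}$ to the entries in $E$). $\langle x,y\rangle=\sum_{(i,j)\in E}x_{ij}y_{ij}$. $dy=\prod_{i\le j,(i,j)\in E}dy_{ij}$. $|\cdot|$ of a matrix is its determinant, of a set its cardinality. **Measures.** For $\alpha:\mathcal{C}\to\mathbb{R}$,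 $\beta:\mathcal{S}\to\mathbb{R}$, $x\in Q_G$: $H_G(\alpha,\beta;x)=\prod_{C\in\mathcal{C}}|x_C|^{\alpha(C)}\big/\prod_{S\in\mathcal{S}}|x_S|^{\nu(S)\beta(S)}$. With $x=\varphi(y)$, $\nu_G(dy)=\prod_{C\in\mathcal{C}}|x_C|^{(|C|+1)/2}\prod_{S\in\mathcal{S}}|x_S|^{-\nu(S)(|S|+1)/2}\,\mathbf 1_{P_G}(y)\,dy$. $\mathcal{B}$ is the set of $(\alpha,\beta)$ such that $J(\alpha,\beta;x)=\int_{P_G}e^{-\langle x,y\rangle}H_G(\alpha,\beta;\varphi(y))\nu_G(dy)$ converges for all $x\in Q_G$ and $x\mapsto J(\alpha,\beta;x)/H_G(\alpha,\beta;x)$ is constant on $Q_G$. **Gamma functions.** $\Gamma_n(p)=\pi^{n(n-1)/4}\prod_{j=1}^n\Gamma(p-\frac{j-1}{2})$. For integers $0<s<c$ a quotient $\Gamma_c(p)/\Gamma_s(p-\frac{c-s}{2})$ is understood, via the identity $\Gamma_c(p)/\Gamma_s(p-\frac{c-s}{2})=\pi^{(c-s)s/2}\Gamma_{c-s}(p)$, as the quantity $\pi^{(c-s)s/2}\Gamma_{c-s}(p)$, which is well defined for $p>\frac{c-s-1}{2}$. **The set $B_P$.** Put $c_j=|C_j|$, $s_j=|S_j|$, $\alpha_j=\alpha(C_j)$, $\beta_j=\beta(S_j)$, $J(P,S)=\{j\in\{2,\dots,k\}:S_j=S\}$. $B_P$ is the set of $(\alpha,\beta)$ such that: (1) $\sum_{j\in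 J(P,S)}\big(\alpha_j+\frac12(c_j-s_j)\big)-\nu(S)\beta(S)=0$ for all $S\in\mathcal{S}$ with $S\neq S_2$; (2) $-\alpha_q-\frac12(c_q-s_q-1)>0$ for all $q=2,\dots,k$ and $-\alpha_1-\frac12(c_1-s_2-1)>0$; (3) $-\alpha_1-\frac12(c_1-s_2+1)-\gamma_2>\frac{s_2-1}{2}$, where $\gamma_2=\sum_{j\in J(P,S_2)}\big(\alpha_j-\beta_2+\frac{c_j-s_2}{2}\big)$. *)

(* Defs.v *)
From HB Require Import structures.
From mathcomp Require Import all_boot all_order all_algebra.
From mathcomp Require Import all_classical all_reals all_analysis.
Set Implicit Arguments.
Unset Strict Implicit.
Unset Printing Implicit Defensive.
Import Order.TTheory GRing.Theory Num.Theory.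
Import numFieldNormedType.Exports.
Local Open Scope ring_scope.

Section Graph.
Variables (r : nat) (e : rel 'I_r).
Implicit Types (A S C : {set 'I_r}) (P : seq {set 'I_r}).

Definition induced_cycle (s : seq 'I_r) : Prop :=
  [/\ uniq s, cycle e s &
      {in s &, forall x y, x != y -> e x y -> y = next s x \/ x = next s y}].

Definition decomposable : Prop :=
  (forall x y, connect e x y) /\
  (forall s, (4 <= size s)%N -> ~ induced_cycle s).

Definition complete_in A : bool := [forall x in A, forall y in A, e x y].

Definition cliques : {set {set 'I_r}} :=
  [set C : {set 'I_r} | maxset complete_in C]%SET.

(* An order (C_1, ..., C_k) is the sequence [:: C_1; ...; C_k]; the indices j of
   nth_clique and sep start at 1, and sep P j is only meaningful for
   2 <= j <= k. *)
Definition nth_clique P (j : nat) : {set 'I_r} := nth finset.set0 P j.-1.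

Definition sep P (j : nat) : {set 'I_r} :=
  ((\bigcup_(1 <= i < j) nth_clique P i) :&: nth_clique P j)%SET.

Definition perfect_order P : Prop :=
  [/\ uniq P, P =i cliques &
      forall j, (2 <= j <= size P)%N ->
        exists2 i, (1 <= i < j)%N & sep P j \subset nth_clique P i].

Definition seps P : {set {set 'I_r}} :=
  [set S in [seq sep P j | j <- index_iota 2 (size P).+1]]%SET.

Definition sep_mult P S : nat :=
  (\sum_(2 <= j < (size P).+1 | sep P j == S) 1)%N.

End Graph.

(* Neither seps nor sep_mult depends on the chosen perfect order: for every A,
   the number of j >= 2 with A \subset S_j is the predecessor of the number of
   cliques containing A, or 0 if there are none. *)
Section Independence.
Variables (r : nat) (e : rel 'I_r).
Implicit Types (A S : {set 'I_r}) (P : seq {set 'I_r}).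

Let count_seps P A n : perfect_order e P -> (0 < n <= size P)%N ->
  (\sum_(2 <= j < n.+1) (A \subset sep P j) =
   (\sum_(1 <= j < n.+1) (A \subset nth_clique P j)).-1)%N.
Proof.
move=> [_ _ Psep]; elim: n => // -[|n] IHn /andP[_ nP].
  by rewrite big_geq// big_nat1; case: (_ \subset _).
rewrite big_nat_recr//= [in RHS]big_nat_recr//= IHn ?(ltnW nP)//.
set N := (\sum_(1 <= j < n.+2) _)%N.
suff -> : (A \subset sep P n.+2) = (A \subset nth_clique P n.+2) && (0 < N)%N.
  by case: (A \subset nth_clique P n.+2); case: N => [|m] //=; rewrite ?addn0 ?addn1.
apply/idP/andP => [AS|[AC N0]].
  split; first exact: fintype.subset_trans AS (finset.subsetIr _ _).
  have [i /andP[i1 iltn] Si] := Psep n.+2 nP.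
  rewrite lt0n; apply/negP => /eqP N0.
  have : (N >= (A \subset nth_clique P i))%N.
    by rewrite /N (big_rem i)/= ?mem_index_iota ?i1// leq_addr.
  by rewrite N0 (fintype.subset_trans AS Si).
rewrite finset.subsetI AC andbT.
have /hasP[i] : has (fun i => A \subset nth_clique P i) (index_iota 1 n.+2).
  apply: contraLR N0; rewrite -all_predC => /allP noA.
  rewrite -leqNgt leqn0 /N big1_seq// => i /andP[_ /noA].
  by move=> /= /negbTE ->.
move=> Ii Ai; apply: fintype.subset_trans Ai _.
by rewrite (big_rem i)//= finset.subsetUl.
Qed.

Lemma perfect_order_sep_mult P P' S :
  perfect_order e P -> perfect_order e P' -> sep_mult P S = sep_mult P' S.
Proof.
have sum_mult Q A : (\sum_(B : {set 'I_r} | A \subset B) sep_mult Q B =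
    \sum_(2 <= j < (size Q).+1) (A \subset sep Q j))%N.
  rewrite /sep_mult (exchange_big_dep predT)//=; apply: eq_bigr => j _.
  have [Aj|Aj] := boolP (A \subset sep Q j); last first.
    by rewrite big_pred0// => B; apply: contraNF Aj => /andP[AB /eqP ->].
  rewrite (big_pred1 (sep Q j))// => B /=; rewrite [RHS]eq_sym.
  by apply/andP/idP => [[]//|/eqP <-].
move=> pP pP'.
have eqN A : (\sum_(2 <= j < (size P).+1) (A \subset sep P j) =
    \sum_(2 <= j < (size P').+1) (A \subset sep P' j))%N.
  have pPP' : perm_eq P P'.
    case: pP pP' => [uP PC _] [uP' P'C _].
    by apply: uniq_perm => // C; rewrite PC P'C.
  have sPP' := perm_size pPP'.
  have [P0|P0] := posnP (size P); first by rewrite -sPP' P0 !big_geq.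
  rewrite !count_seps ?leqnn ?andbT -?sPP'//; congr predn.
  rewrite !big_add1 /= /nth_clique /=.
  rewrite -(big_nth finset.set0 predT (fun C => nat_of_bool (A \subset C))).
  rewrite [in RHS]sPP'.
  rewrite -(big_nth finset.set0 predT (fun C => nat_of_bool (A \subset C))).
  exact: perm_big.
have [n] := ubnP (r - #|S|)%N; elim: n S => // n IHn S leSn.
have := eqN S; rewrite -!sum_mult (bigD1 S)//= [in RHS](bigD1 S)//=.
rewrite (eq_bigr (sep_mult P')) => [/addIn//|B /andP[SB BS]].
apply: IHn; rewrite ltnS in leSn; apply: leq_trans leSn.
have SB' : S \proper B by rewrite finset.properEneq eq_sym BS.
have := proper_card SB'; have := max_card (mem B); rewrite card_ord => Br Slt.
by rewrite ltn_sub2l// (leq_trans Slt).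
Qed.

Lemma perfect_order_seps P P' :
  perfect_order e P -> perfect_order e P' -> seps P = seps P'.
Proof.
have memE Q S : (S \in seps Q) = (0 < sep_mult Q S)%N.
  rewrite !inE /sep_mult; apply/mapP/idP => [[j jQ ->]|].
    by rewrite (big_rem j)//= eqxx.
  rewrite sum1_count -has_count => /hasP[j jQ /= /eqP jS].
  by exists j.
by move=> pP pP'; apply/setP => S; rewrite !memE (perfect_order_sep_mult S pP pP').
Qed.

End Independence.

Local Open Scope classical_set_scope.

Section LebesgueTuple.
Variable R : realType.
Local Notation RT := (measurableTypeR R).
Implicit Types n : nat.

Definition cons_pair n (p : RT * n.-tuple RT) : n.+1.-tuple RT :=
  [tuple of p.1 :: p.2].

Lemma measurable_cons_pair n :
  measurable_fun [set: RT * n.-tuple RT] (@cons_pair n).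
Proof. exact: measurable_cons. Qed.

HB.instance Definition _ n :=
  isMeasurableFun.Build _ _ _ _ (@cons_pair n) (@measurable_cons_pair n).

Section step.
Variables (n : nat) (m : {sigma_finite_measure set (n.-tuple RT) -> \bar R}).

Definition cons_measure : set (n.+1.-tuple RT) -> \bar R :=
  pushforward (lebesgue_measure \x m)%E (@cons_pair n).

Let cons_measureE : cons_measure =
  pushforward (lebesgue_measure \x m)%E (@cons_pair n : {mfun _ >-> _}).
Proof. by []. Qed.

Let cons_measure0 : cons_measure set0 = 0%E.
Proof. by rewrite cons_measureE measure0. Qed.

Let cons_measure_ge0 A : (0 <= cons_measure A)%E.
Proof. by rewrite cons_measureE measure_ge0. Qed.

Let cons_measure_sigma_additive : semi_sigma_additive cons_measure.
Proof. by rewrite cons_measureE; exact: measure_semi_sigma_additive. Qed.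

HB.instance Definition _ := isMeasure.Build _ _ _ cons_measure
  cons_measure0 cons_measure_ge0 cons_measure_sigma_additive.

Let cons_measure_sigma_finite : sigma_finite setT cons_measure.
Proof.
have /sigma_finiteP[F [TF ndF Foo]] := sigma_finiteT (@lebesgue_measure R).
have /sigma_finiteP[G [TG ndG Goo]] := sigma_finiteT m.
pose tb (t : n.+1.-tuple RT) : RT * n.-tuple RT := (thead t, [tuple of behead t]).
have mtb : measurable_fun setT tb.
  apply/measurable_fun_pair; first exact: measurable_tnth.
  exact: measurable_behead.
have cK : cancel (@cons_pair n) tb.
  by move=> [x t]; congr pair => //; apply/val_inj.
exists (fun i => tb @^-1` (F i `*` G i)).
  rewrite -preimage_bigcup (_ : \bigcup_i _ = setT) ?preimage_setT//.
  apply/seteqP; split => // -[x t] _.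
  have [i _ Fix_] : (\bigcup_i F i) x by rewrite -TF.
  have [j _ Gjt] : (\bigcup_i G i) t by rewrite -TG.
  exists (maxn i j) => //; split.
  - by move: x Fix_; exact/subsetPset/ndF/leq_maxl.
  - by move: t Gjt; exact/subsetPset/ndG/leq_maxr.
move=> i; have [mF Fi] := Foo i; have [mG Gi] := Goo i; split.
  by rewrite -[X in measurable X]setTI; apply: mtb => //; exact: measurableX.
rewrite /cons_measure /pushforward -comp_preimage (_ : tb \o _ = id); last first.
  by apply/funext => x; exact: cK.
by rewrite preimage_id product_measure1E// lte_mul_pinfty// ge0_fin_numE.
Qed.

HB.instance Definition _ :=
  Measure_isSigmaFinite.Build _ _ _ cons_measure cons_measure_sigma_finite.

End step.

Fixpoint lebesgue_tuple n : {sigma_finite_measure set (n.-tuple RT) -> \bar R} :=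
  match n with
  | 0 => \d_([tuple])
  | n'.+1 => cons_measure (lebesgue_tuple n')
  end.

End LebesgueTuple.

Section Cones.
Variables (R : realType) (r : nat) (e : rel 'I_r).
Implicit Types (C S : {set 'I_r}) (P : seq {set 'I_r}) (x y : 'M[R]_r).
Local Notation RT := (measurableTypeR R).
Local Notation weight := ({set 'I_r} -> R).

Definition posdef n (M : 'M[R]_n) : Prop :=
  M^T = M /\ forall u : 'rV[R]_n, u != 0 -> 0 < (u *m M *m u^T) 0 0.

Definition princ_mx (C : {set 'I_r}) x : 'M[R]_#|C| :=
  mxsub (@enum_val _ (mem C)) (@enum_val _ (mem C)) x.

(* Both spaces of the text are carried by the symmetric matrices vanishing off E:
   Z_G literally, and I_G by extending a function on E by zero. *)
Definition sym_on_edges : set 'M[R]_r :=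
  [set x | x^T = x /\ forall i j, ~~ e i j -> x i j = 0].

Definition PG : set 'M[R]_r := [set y | sym_on_edges y /\ posdef y].

Definition QG : set 'M[R]_r :=
  [set x | sym_on_edges x /\ forall C, C \in cliques e -> posdef (princ_mx C x)].

Definition phiG y : 'M[R]_r :=
  \matrix_(i, j) if e i j then invmx y i j else 0.

Definition pairing x y : R := \sum_i \sum_(j | e i j) x i j * y i j.

Definition HG P (alpha beta : weight) x : R :=
  (\prod_(C in cliques e) (\det (princ_mx C x)) `^ alpha C) /
  (\prod_(S in seps P)
     (\det (princ_mx S x)) `^ ((sep_mult P S)%:R * beta S)).

(* The density of nu_G on P_G with respect to dy. *)
Definition nuG_density P y : R :=
  (\prod_(C in cliques e)
     (\det (princ_mx C (phiG y))) `^ ((#|C|%:R + 1) / 2)) *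
  (\prod_(S in seps P)
     (\det (princ_mx S (phiG y))) `^ (- ((sep_mult P S)%:R * (#|S|%:R + 1) / 2))).

Definition edge_coords : {set 'I_r * 'I_r} :=
  [set p : 'I_r * 'I_r | (p.1 <= p.2)%N && e p.1 p.2]%SET.

(* The element of Z_G with coordinates (y_ij), i <= j, (i, j) in E. When (i, j)
   is not an edge the index is out of range and the default value 0 is read. *)
Definition mx_of_coords (t : #|edge_coords|.-tuple RT) : 'M[R]_r :=
  \matrix_(i, j)
    nth 0 t (index (if (i <= j)%N then (i, j) else (j, i)) (enum edge_coords)).

Definition PG_coords : set (#|edge_coords|.-tuple RT) :=
  [set t | PG (mx_of_coords t)].

(* J(alpha, beta; x) is the integral over P_G, against dy (Lebesgue measure in the
   coordinates above), of this integrand, which includes the density of nu_G. *)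
Definition J_integrand P (alpha beta : weight) x y : R :=
  expR (- pairing x y) * HG P alpha beta (phiG y) * nuG_density P y.

Definition J_converges P (alpha beta : weight) x : Prop :=
  (lebesgue_tuple R #|edge_coords|).-integrable PG_coords
    (fun t => (J_integrand P alpha beta x (mx_of_coords t))%:E).

Definition J P (alpha beta : weight) x : R :=
  \int[lebesgue_tuple R #|edge_coords|]_(t in PG_coords)
    J_integrand P alpha beta x (mx_of_coords t).

Definition calB P : set (weight * weight) :=
  [set ab | (forall x, QG x -> J_converges P ab.1 ab.2 x) /\
            (exists c : R, forall x, QG x ->
               J P ab.1 ab.2 x / HG P ab.1 ab.2 x = c)].

End Cones.

Section GammaFunctions.
Variables (R : realType) (r : nat).
Implicit Types (p : R) (P : seq {set 'I_r}).
Local Notation weight := ({set 'I_r} -> R).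

Definition Gamma p : R :=
  \int[lebesgue_measure]_(t in `]0, +oo[) (t `^ (p - 1) * expR (- t)).

Definition mvGamma (n : nat) p : R :=
  pi `^ ((n * n.-1)%:R / 4) * \prod_(1 <= j < n.+1) Gamma (p - j.-1%:R / 2).

(* The quotient Gamma_c(p) / Gamma_s(p - (c - s)/2), for 0 < s < c, understood as
   pi^((c - s) s / 2) Gamma_(c - s)(p), which only requires p > (c - s - 1) / 2. *)
Definition mvGamma_quot (c s : nat) p : R :=
  pi `^ (((c - s) * s)%:R / 2) * mvGamma (c - s) p.

Section Order.
Variable P : seq {set 'I_r}.
Local Notation k := (size P).
Local Notation c j := (#|nth_clique P j|).
Local Notation s j := (#|sep P j|).

Definition gamma2 (alpha beta : weight) : R :=
  \sum_(2 <= j < k.+1 | sep P j == sep P 2)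
    (alpha (nth_clique P j) - beta (sep P 2) + ((c j)%:R - (s 2)%:R) / 2).

Definition BP : set (weight * weight)%type :=
  [set ab | let alpha := ab.1 in let beta := ab.2 in
    [/\ forall S, S \in seps P -> S != sep P 2 ->
          \sum_(2 <= j < k.+1 | sep P j == S)
             (alpha (nth_clique P j) + ((c j)%:R - (s j)%:R) / 2)
          - (sep_mult P S)%:R * beta S = 0,
        forall q, (2 <= q <= k)%N ->
          0 < - alpha (nth_clique P q) - ((c q)%:R - (s q)%:R - 1) / 2,
        0 < - alpha (nth_clique P 1) - ((c 1)%:R - (s 2)%:R - 1) / 2 &
        ((s 2)%:R - 1) / 2 <
          - alpha (nth_clique P 1) - ((c 1)%:R - (s 2)%:R + 1) / 2
          - gamma2 alpha beta]].

Definition GammaII (alpha beta : weight) : R :=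
  mvGamma (s 2)
    (- alpha (nth_clique P 1) - ((c 1)%:R - (s 2)%:R) / 2 - gamma2 alpha beta) *
  mvGamma_quot (c 1) (s 2) (- alpha (nth_clique P 1)) *
  \prod_(2 <= j < k.+1) mvGamma_quot (c j) (s j) (- alpha (nth_clique P j)).

End Order.
End GammaFunctions.

(* Main.v *)
Require Import Defs.
From HB Require Import structures.
From mathcomp Require Import all_boot all_order all_algebra.
From mathcomp Require Import perm.
From mathcomp Require Import all_classical all_reals all_analysis.
From mathcomp Require Import measurable_realfun.
From mathcomp Require Import ring lra.
Set Implicit Arguments.
Unset Strict Implicit.
Unset Printing Implicit Defensive.
Import Order.TTheory GRing.Theory Num.Theory.
Import numFieldNormedType.Exports.
Local Open Scope classical_set_scope.
Local Open Scope ring_scope.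

(** Eliminate the vertices one at a time, in the order opposite to a perfect
    vertex ordering adapted to P, namely S_2, C_1 \ S_2, C_2 \ S_2, ..., C_k \ S_k.
    The neighbours N of the vertex v being eliminated form a complete set, so with
    t = y_vv and b = (y_vn), n in N, the Schur complement y - b b^T / t only
    translates the entries of y indexed by edges inside N, and
    |x_N| / |x_(N + v)| = t for x = phi(y). By condition (1) of B_P, the integrand
    is exp(-<theta, y>) times a product over the vertices of powers of these
    pivots t: the exponent is constant on each C_j \ S_j, and the leftover power
    gamma_2 of |x_(S_2)| is absorbed by the vertices of S_2. The integral therefore
    factors; each vertex contributes a Gaussian integral in b with matrix
    theta_N / t, followed by a one-dimensional Gamma integral in t, and the
    resulting constants telescope along each C_j \ S_j. *)

(** * One-dimensional integrals *)

(** The cone P_G is never parametrised. A symmetric matrix is positive definite exactly when all its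
    successive pivots are positive, so giving the integrand the value 0 as soon as a pivot fails to
    be positive extends it to a nonnegative measurable function on all of R^E. Tonelli then permits
    integration in elimination order, and finiteness of the result is the integrability claim.

    The link between pivots and minors of x is Cramer's rule: x stays inverse to y on the remaining
    vertices after each Schur complement, so a pivot t is a diagonal entry of the inverse of x_(N +
    v).

    The exponent on C_j \ S_j is alpha_j + (c_j + 1)/2, the joint power of |x_(C_j)| in H_G and
    nu_G. After the Gaussian integral, the Gamma integral in t converges when |N|/2 - a + 1 > 0, a
    being the exponent. In the block C_j \ S_j the smallest N is S_j, and the requirement becomes
    condition (2); condition (3) covers S_2. That S_2 lies inside C_1 is what allows it to be
    eliminated last, with an exponent of its own. *)

Section LebesgueAffine.
Variable R : realType.
Local Notation RT := (measurableTypeR R).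
Local Notation mu := (@lebesgue_measure R).
Implicit Type f : R -> \bar R.

Let tr (c : R) : RT -> RT := fun x : R => x + c.
Let sc (c : R) : RT -> RT := fun x : R => c * x.

Let mtr c : measurable_fun setT (tr c).
Proof.
suff : measurable_fun [set: R] (fun x : R => x + c) by [].
exact: measurable_funD.
Qed.

Let msc c : measurable_fun setT (sc c).
Proof.
suff : measurable_fun [set: R] (fun x : R => c * x) by [].
exact: measurable_funM.
Qed.

HB.instance Definition _ c := isMeasurableFun.Build _ _ RT RT (tr c) (mtr c).
HB.instance Definition _ c := isMeasurableFun.Build _ _ RT RT (sc c) (msc c).

(** The image of Lebesgue measure under a translation agrees with it on half-open intervals, hence
    everywhere. The scaling lemma below follows the same route, with a factor c. *)
Lemma ge0_integral_shift f (c : R) : measurable_fun [set: R] f ->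
  (forall x, 0 <= f x)%E ->
  (\int[mu]_x f (x + c)%R = \int[mu]_x f x)%E.
Proof.
move=> mf f0; transitivity (\int[pushforward mu (tr c)]_x f x)%E.
  by rewrite ge0_integral_pushforward ?preimage_setT// => ? _; exact: f0.
apply: eq_measure_integral => //= A mA _; apply/esym.
apply: (@lebesgue_measure_unique R (pushforward mu (tr c))) => //= _ [[a b]] _ <-.
rewrite /pushforward (_ : _ @^-1` _ = `]a - c, b - c]%classic); last first.
  by apply/seteqP; split=> x /=; rewrite !in_itv/= ltrBlDr lerBrDr.
rewrite !lebesgue_measure_itv/= !lte_fin ltrD2r.
by case: ifPn => // _; rewrite -!EFinB; congr (_%:E); ring.
Qed.

Lemma ge0_integral_scale f (c : R) : 0 < c -> measurable_fun [set: R] f ->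
  (forall x, 0 <= f x)%E ->
  (\int[mu]_x f (c * x)%R = c^-1%:E * \int[mu]_x f x)%E.
Proof.
move=> c0 mf f0.
have ci : 0 <= c^-1 by rewrite invr_ge0 ltW.
transitivity (\int[pushforward mu (sc c)]_x f x)%E.
  by rewrite ge0_integral_pushforward ?preimage_setT// => ? _; exact: f0.
rewrite -(ge0_integral_mscale mu measurableT (NngNum ci))//=.
apply: eq_measure_integral => //= A mA _.
rewrite /mscale/=.
suff -> : mu A = (c%:E * pushforward mu (sc c) A)%E.
  by rewrite muleA -EFinM mulVf ?mul1e// gt_eqF.
have cge0 := ltW c0.
apply: (@lebesgue_measure_unique R
  (mscale (NngNum cge0) (pushforward mu (sc c)))) => //= _ [[a b]] _ <-.
rewrite /mscale/= /pushforward (_ : _ @^-1` _ = `]a / c, b / c]%classic); last first.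
  apply/seteqP; split=> x /=; rewrite !in_itv/=;
  by rewrite ltr_pdivrMr// ler_pdivlMr// ![x * c]mulrC.
rewrite !lebesgue_measure_itv/= !lte_fin ltr_pM2r ?invr_gt0//.
case: ifPn => // _; rewrite ?mule0// -!EFinB -EFinM; congr (_%:E); field.
exact: lt0r_neq0.
Qed.

End LebesgueAffine.

Section OneDimensionalIntegrals.
Variable R : realType.
Local Notation RT := (measurableTypeR R).
Local Notation mu := (@lebesgue_measure R).

(** Up to normalisation the integrand is the normal density of mean -c and variance 1/(2k). *)
Lemma integral_gauss_affine (k c : R) : 0 < k ->
  (\int[mu]_x (expR (- (k * (x + c) ^+ 2)))%:E = (Num.sqrt (pi / k))%:E)%E.
Proof.
move=> k0; pose s := Num.sqrt (k *+ 2)^-1.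
have k2 : 0 < (k *+ 2)^-1 by rewrite invr_gt0 mulrn_wgt0.
have s0 : s != 0 by rewrite gt_eqF// sqrtr_gt0.
have s2 : s ^+ 2 = (k *+ 2)^-1 by rewrite sqr_sqrtr// ltW.
have kn := lt0r_neq0 k0.
have peakE : normal_peak s = (Num.sqrt (pi / k))^-1.
  rewrite /normal_peak s2; congr (Num.sqrt _)^-1.
  by move: pi => q; field.
have := integral_normal_pdf (- c) s; rewrite normal_pdfE// => intE.
transitivity (\int[mu]_x ((Num.sqrt (pi / k))%:E *
    (normal_peak s * normal_fun (- c) s x)%:E))%E.
  apply: eq_integral => x _; rewrite -EFinM; congr (_%:E).
  rewrite peakE [RHS]mulrA divff ?mul1r; last first.
    by rewrite gt_eqF// sqrtr_gt0 divr_gt0// pi_gt0.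
  rewrite /normal_fun; congr expR; rewrite s2 opprK.
  by field.
rewrite ge0_integralZl_EFin//.
- by rewrite intE mule1.
- by move=> x _; rewrite lee_fin mulr_ge0 ?normal_peak_ge0 ?normal_fun_ge0.
- apply/measurable_EFinP; apply: measurable_funM => //.
  exact: measurable_normal_fun.
Qed.

Let Gint (p x : R) := x `^ (p - 1) * expR (- x).

Let mGint p : measurable_fun [set: R] (Gint p).
Proof.
apply: measurable_funM; first exact: measurable_powR.
by apply: measurableT_comp => //; exact: measurable_funN.
Qed.

(** A majorant with an explicit bounded primitive, -(1 + x^p)^-1, whose values lie between -1 and 0.
    It behaves like x^(p-1) near 0 and like x^(-p-1) at infinity, so it dominates the Gamma
    integrand at both ends at once. *)
Let dom (p x : R) := (1 + x `^ p) ^- 2 * (p * x `^ (p - 1)).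

Let is_derive_dom (p x : R) : 0 < x ->
  is_derive x 1 (fun x => - (1 + x `^ p)^-1) (dom p x).
Proof.
move=> x0; have xp := powR_gt0 p x0.
have D1 : is_derive x 1 (fun x => 1 + x `^ p) (p * x `^ (p - 1)).
  have := is_deriveD (is_derive_cst (1 : R) x 1) (is_derive1_powR p x0).
  by rewrite add0r.
have D2 : is_derive x 1 (fun x => (1 + x `^ p)^-1)
    (- (1 + x `^ p) ^- 2 *: (p * x `^ (p - 1))).
  apply: (@is_deriveV _ (fun x => 1 + x `^ p)) => //=.
  by rewrite lt0r_neq0// addr_gt0.
have := is_deriveN D2; rewrite scaleNr opprK; exact.
Qed.

Let dom_cont (p x : R) : 0 < x -> {for x, continuous (dom p)}.
Proof.
move=> x0; have xp := powR_gt0 p x0.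
have cpow q : {for x, continuous (@powR R ^~ q)}.
  by apply/differentiable_continuous/derivable1_diffP/derivable_powR; rewrite in_itv/= x0.
apply: cvgM; last by apply: cvgM; [exact: cvg_cst|exact: cpow].
apply: cvgV; first by rewrite expf_neq0// gt_eqF// addr_gt0.
have c1 : {for x, continuous (fun y => 1 + y `^ p)}.
  by apply: cvgD; [exact: cvg_cst|exact: cpow].
exact: (cvgM c1 c1).
Qed.

Let int_dom (p a b : R) : 0 < a -> a < b ->
  (\int[mu]_(x in `[a, b]) (dom p x)%:E <= 1)%E.
Proof.
move=> a0 ab; have b0 := lt_trans a0 ab.
have dF x : 0 < x -> derivable (fun x => - (1 + x `^ p)^-1) x 1.
  by move=> x0; apply: ex_derive; exact: is_derive_dom.
have cF x : 0 < x -> {for x, continuous (fun x => - (1 + x `^ p)^-1)}.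
  by move=> x0; apply/differentiable_continuous/derivable1_diffP/dF.
rewrite (@continuous_FTC2 _ _ (fun x => - (1 + x `^ p)^-1))//.
- rewrite -EFinB lee_fin opprK.
  have := powR_ge0 a p; have := powR_ge0 b p => bp ap.
  rewrite addrC (le_trans (_ : _ <= (1 + a `^ p)^-1))//.
    by rewrite gerBl invr_ge0 addr_ge0.
  by rewrite invf_le1 ?lerDl// ltr_wpDr.
- apply: continuous_in_subspaceT => x; rewrite inE/= in_itv/= => /andP[ax _].
  by apply: dom_cont; exact: lt_le_trans ax.
- split.
  + by move=> x; rewrite in_itv/= => /andP[ax _]; apply: dF; exact: lt_trans ax.
  + by apply: cvg_at_right_filter; exact: cF.
  + by apply: cvg_at_left_filter; exact: cF.
- move=> x; rewrite in_itv/= => /andP[ax _].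
  by rewrite derive1E; apply: derive_val; apply: is_derive_dom; exact: lt_trans ax.
Qed.

Let Gint_dom (p : R) : 0 < p ->
  exists2 K : R, 0 <= K & forall x, 0 < x -> Gint p x <= K * dom p x.
Proof.
(* [K0] is (2p)^p: from ln z < z at z = x/(2p) comes x^p <= (2p)^p e^(x/2). Adding 1 and squaring
   turns this into (1 + x^p)^2 <= (1 + K0)^2 e^x, which is the domination with constant (1 + K0)^2 /
   p. *)
move=> p0; pose K0 := expR (p * ln (2 * p)).
have K00 : 0 < K0 by exact: expR_gt0.
exists ((1 + K0) ^+ 2 / p) => [|x x0].
  by rewrite divr_ge0 ?exprn_ge0 ?addr_ge0 ?ltW.
have p2 : 0 < 2 * p by rewrite mulr_gt0.
have xpK : x `^ p <= K0 * expR (x / 2).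
  rewrite /powR gt_eqF// /K0 -expRD ler_expR.
  rewrite (_ : ln x = ln (2 * p) + ln (x / (2 * p))); last first.
    by rewrite -lnM ?posrE ?divr_gt0//; congr ln; field; rewrite gt_eqF.
  rewrite mulrDr lerD2l -ler_pdivlMl//.
  have := ltW (ln_sublinear (divr_gt0 x0 p2)); congr (_ <= _).
  by field; rewrite gt_eqF.
have e1 : 1 <= expR (x / 2) by rewrite -expR0 ler_expR divr_ge0// ltW.
have key : 1 + x `^ p <= (1 + K0) * expR (x / 2).
  by rewrite mulrDl mul1r lerD.
have xp1 : 0 < 1 + x `^ p by rewrite ltr_wpDr// powR_ge0.
have {}key : (1 + x `^ p) ^+ 2 <= (1 + K0) ^+ 2 * expR x.
  rewrite (_ : expR x = expR (x / 2) ^+ 2); last first.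
    by rewrite expr2 -expRD; congr expR; lra.
  by rewrite -exprMn lerXn2r// nnegrE ltW// (lt_le_trans xp1).
rewrite /Gint /dom (_ : _ * _ * _ =
  x `^ (p - 1) * ((1 + K0) ^+ 2 / (1 + x `^ p) ^+ 2)); last first.
  by field; rewrite !gt_eqF.
rewrite ler_wpM2l ?powR_ge0// ler_pdivlMr ?exprn_gt0//.
by rewrite expRN mulrC ler_pdivrMr ?expR_gt0.
Qed.

Lemma integral_Gamma_fin_num (p : R) : 0 < p ->
  (\int[mu]_(x in `]0%R, +oo[) (x `^ (p - 1) * expR (- x))%:E \is a fin_num)%E.
Proof.
move=> p0; have [K K0 GK] := Gint_dom p0.
(* Starting at n + 2 keeps every interval nondegenerate, as [int_dom] wants a < b. The integrals
   over this exhaustion are all at most [K]. *)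
pose F (n : nat) : set R := `[n.+2%:R^-1, n.+2%:R]%classic.
have FE : \bigcup_i F i = `]0, +oo[%classic.
  apply/seteqP; split => x /=.
    move=> [i _]; rewrite /F/= !in_itv/= andbT => /andP[+ _].
    by apply: lt_le_trans; rewrite invr_gt0.
  rewrite in_itv/= andbT => x0.
  have xi := invr_gt0 x; rewrite x0 in xi.
  pose m := maxn (Num.truncn x) (Num.truncn x^-1).
  exists m => //; rewrite /F/= in_itv/=; apply/andP; split.
    rewrite -[leRHS]invrK lef_pV2 ?posrE//.
    apply: le_trans (ltW (truncnS_gt _)) _; rewrite ler_nat ltnS.
    by rewrite (leq_trans (leq_maxr _ _) (leqnSn _)).
  apply: le_trans (ltW (truncnS_gt _)) _; rewrite ler_nat ltnS.
  by rewrite (leq_trans (leq_maxl _ _) (leqnSn _)).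
have G0 x : (0 <= (Gint p x)%:E)%E.
  by rewrite lee_fin mulr_ge0 ?powR_ge0 ?expR_ge0.
rewrite ge0_fin_numE; last by apply: integral_ge0 => x _; exact: G0.
apply: (@le_lt_trans _ _ K%:E); last exact: ltry.
rewrite -FE.
have mG A : measurable_fun A (EFin \o Gint p).
  by apply: measurable_funTS; apply/measurable_EFinP.
have ndF : nondecreasing_seq F.
  apply/nondecreasing_seqP => n; rewrite subsetEset => x /=.
  rewrite /F/= !in_itv/= => /andP[h1 h2]; apply/andP; split.
    by apply: le_trans h1; rewrite lef_pV2 ?posrE// ler_nat.
  by apply: le_trans h2 _; rewrite ler_nat.
have mF i : measurable (F i) by exact: measurable_itv.
have /cvg_lim <-// : (\int[mu]_(x in F i) (Gint p x)%:E @[i --> \oo] -->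
    \int[mu]_(x in \bigcup_i F i) (Gint p x)%:E)%E.
  by apply: ge0_nondecreasing_set_cvg_integral => // i; exact: mG.
apply: lime_le.
  apply: ereal_nondecreasing_is_cvgn.
  by apply: ge0_nondecreasing_set_nondecreasing_integral => // i; exact: mG.
near=> n.
have n0 : 0 < n.+2%:R^-1 :> R by rewrite invr_gt0.
have F0 x : F n x -> 0 < x.
  by rewrite /F/= in_itv/= => /andP[+ _]; exact: lt_le_trans.
have mdom : measurable_fun (F n) (dom p).
  apply: subspace_continuous_measurable_fun => //.
  apply: continuous_in_subspaceT => x; rewrite inE => /F0 x0.
  exact: dom_cont.
have dom0 x : F n x -> 0 <= dom p x.
  move=> Fx; rewrite /dom mulr_ge0 ?mulr_ge0 ?powR_ge0 ?(ltW p0)//.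
  by rewrite invr_ge0 exprn_ge0// addr_ge0// powR_ge0.
apply: (@le_trans _ _ (\int[mu]_(x in F n) (K%:E * (dom p x)%:E)))%E.
  apply: ge0_le_integral; first exact: mF.
  - by move=> x _; exact/G0.
  - exact: mG.
  - by apply/measurable_EFinP; exact: measurable_funM.
  - by move=> x /F0 x0; rewrite -EFinM lee_fin GK.
have dom0E x : F n x -> (0 <= (dom p x)%:E)%E by rewrite lee_fin; exact: dom0.
rewrite ge0_integralZl_EFin; [|exact: mF|exact: dom0E|exact/measurable_EFinP|exact: K0].
rewrite -[leRHS]mule1 lee_wpmul2l//.
apply: int_dom => //.
by apply: (@lt_trans _ _ 1); rewrite ?invf_lt1 ?ltr1n.
Unshelve. all: by end_near. Qed.

(** Substitution x -> d x. The integrand is extended by 0 to the whole line because a pivot, as a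
    coordinate, ranges over all of R. *)
Lemma integral_Gamma_scale (p d : R) : 0 < p -> 0 < d ->
  (\int[mu]_x (if (0 < x)%R then x `^ (p - 1) * expR (- (x * d)) else 0)%:E =
   (Gamma p * d `^ (- p))%:E)%E.
Proof.
move=> p0 d0.
pose f := fun x : R => (if 0 < x then Gint p x else 0)%:E.
have mf : measurable_fun [set: R] f.
  apply/measurable_EFinP; apply: measurable_fun_ifT => //.
  exact: measurable_fun_ltr.
have f0 x : (0 <= f x)%E.
  rewrite /f lee_fin; case: ifPn => // x0.
  by rewrite mulr_ge0 ?powR_ge0 ?expR_ge0.
have intf : (\int[mu]_x f x = (Gamma p)%:E)%E.
  rewrite /Gamma /Rintegral fineK ?integral_Gamma_fin_num//.
  rewrite [RHS]integral_mkcond; apply: eq_integral => x _.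
  by rewrite /f /patch mem_setE in_itv/= andbT; case: ifPn.
transitivity (\int[mu]_x ((d `^ (1 - p))%:E * f (d * x)%R))%E.
  apply: eq_integral => x _; rewrite /f -EFinM pmulr_rgt0//; congr (_%:E).
  case: ifPn => x0; last by rewrite mulr0.
  rewrite /Gint powRM ?ltW// [RHS]mulrA [X in _ = X * _]mulrA -powRD; last first.
    by rewrite (gt_eqF d0) implybT.
  by rewrite subrKA subrr powRr0 mul1r [x * d]mulrC.
rewrite ge0_integralZl_EFin//.
- rewrite ge0_integral_scale// intf -!EFinM; congr (_%:E).
  rewrite -powR_inv1 ?(ltW d0)// mulrA mulrC -powRD; last first.
    by rewrite (gt_eqF d0) implybT.
  by congr (_ * _ `^ _); lra.
- apply: measurableT_comp => //; exact: measurable_funM.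
- exact: powR_ge0.
Qed.

Lemma Gamma_ge0 (p : R) : 0 <= Gamma p.
Proof.
rewrite /Gamma /Rintegral fine_ge0// integral_ge0// => x _.
by rewrite lee_fin mulr_ge0 ?powR_ge0 ?expR_ge0.
Qed.

End OneDimensionalIntegrals.

(** * Iterated integrals over coordinates *)

Section IteratedIntegral.
Variable R : realType.
Local Notation RT := (measurableTypeR R).
Local Notation mu := (@lebesgue_measure R).

Section tuples.
Variable n : nat.
Local Notation T := (n.-tuple RT).
Implicit Types (t : T) (k : nat) (s : seq nat) (F : T -> \bar R).

Definition upd t k (x : R) : T :=
  [tuple (if val j == k then x else tnth t j) | j < n].

Lemma nth_upd t k x m :
  nth 0 (upd t k x) m = if (m == k) && (m < n)%N then x else nth 0 t m.
Proof.
have [mn|mn] := ltnP m n; last by rewrite andbF !nth_default ?size_tuple.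
by rewrite -(tnth_nth 0 (upd t k x) (Ordinal mn)) tnth_mktuple/= andbT (tnth_nth 0).
Qed.

Lemma upd_upd t k l x y : k != l -> upd (upd t k x) l y = upd (upd t l y) k x.
Proof.
move=> kl; apply/eq_from_tnth => j; rewrite !tnth_mktuple.
by case: eqP => // ->; rewrite eq_sym (negbTE kl).
Qed.

Lemma measurable_upd k :
  measurable_fun [set: T * RT] (fun p => upd p.1 k p.2).
Proof.
apply/measurable_fun_tnthP => j; rewrite /comp.
under eq_fun do rewrite tnth_mktuple.
have [_|_] := eqVneq (val j) k; first exact: measurable_snd.
by apply: (measurableT_comp (measurable_tnth j)); exact: measurable_fst.
Qed.

Lemma measurable_nth k : measurable_fun [set: T] (fun t => nth 0 t k : R).
Proof.
have [kn|kn] := ltnP k n; last first.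
  by rewrite (_ : (fun t => _) = cst 0)//; apply/funext => t; rewrite nth_default ?size_tuple.
under eq_fun do rewrite -(tnth_nth 0 _ (Ordinal kn)).
exact: measurable_tnth.
Qed.

(** The result is still a function of the whole tuple, merely constant in coordinate k. All partial
    integrals thus have one type, whatever the order of integration. *)
Definition int1 k F t : \bar R := (\int[mu]_x F (upd t k x))%E.

Definition iterint s F : T -> \bar R := foldr int1 F s.

Lemma iterint_cat s1 s2 F : iterint (s1 ++ s2) F = iterint s1 (iterint s2 F).
Proof. by rewrite /iterint foldr_cat. Qed.

Lemma eq_int1 k F G : F =1 G -> int1 k F =1 int1 k G.
Proof. by move=> FG t; apply: eq_integral => x _; rewrite FG. Qed.

Lemma eq_iterint s F G : F =1 G -> iterint s F =1 iterint s G.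
Proof. by move=> FG; elim: s => //= k s; exact: eq_int1. Qed.

Lemma int1_ge0 k F : (forall t, 0 <= F t)%E -> forall t, (0 <= int1 k F t)%E.
Proof. by move=> F0 t; apply: integral_ge0 => x _; exact: F0. Qed.

Lemma iterint_ge0 s F :
  (forall t, 0 <= F t)%E -> forall t, (0 <= iterint s F t)%E.
Proof. by move=> F0; elim: s => //= k s; exact: int1_ge0. Qed.

Lemma measurable_int1 k F : (forall t, 0 <= F t)%E ->
  measurable_fun setT F -> measurable_fun setT (int1 k F).
Proof.
move=> F0 mF.
apply: (@measurable_fun_fubini_tonelli_F _ _ T RT R mu
  (fun p : T * RT => F (upd p.1 k p.2))) => //.
exact: measurableT_comp mF (measurable_upd k).
Qed.

Lemma measurable_iterint s F : (forall t, 0 <= F t)%E ->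
  measurable_fun setT F -> measurable_fun setT (iterint s F).
Proof.
by move=> F0 mF; elim: s => //= k s; apply: measurable_int1; exact: iterint_ge0.
Qed.

Lemma measurable_upd1 t k : measurable_fun setT (upd t k : RT -> T).
Proof.
apply/measurable_fun_tnthP => j; rewrite /comp.
under eq_fun do rewrite tnth_mktuple.
by case: eqP => _; [exact: measurable_id|exact: measurable_cst].
Qed.

Lemma int1C k l F : (forall t, 0 <= F t)%E -> measurable_fun setT F ->
  int1 k (int1 l F) =1 int1 l (int1 k F).
Proof.
move=> F0 mF t; have [->//|kl] := eqVneq k l.
pose f (p : RT * RT) := F (upd (upd t k p.1) l p.2).
have mf : measurable_fun setT f.
  apply: (measurableT_comp mF).
  apply: (measurableT_comp (measurable_upd l)
    (g := fun p : RT * RT => (upd t k p.1, p.2))).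
  apply/measurable_fun_pair => //=.
  exact: (measurableT_comp (measurable_upd1 t k)).
transitivity (\int[mu]_y \int[mu]_x f (x, y))%E.
  exact: (fubini_tonelli f mf (fun p => F0 _)).
by apply: eq_integral => y _; apply: eq_integral => x _; rewrite /f upd_upd.
Qed.

Lemma int1_iterintC k s F : (forall t, 0 <= F t)%E -> measurable_fun setT F ->
  int1 k (iterint s F) =1 iterint s (int1 k F).
Proof.
move=> F0 mF; elim: s => //= l s IHs t.
rewrite int1C//; [|exact: iterint_ge0|exact: measurable_iterint].
exact: eq_int1.
Qed.

Lemma iterintC s1 s2 F : (forall t, 0 <= F t)%E -> measurable_fun setT F ->
  iterint s1 (iterint s2 F) =1 iterint s2 (iterint s1 F).
Proof.
move=> F0 mF; elim: s1 => //= k s1 IHs t.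
rewrite (eq_int1 _ IHs) int1_iterintC//.
- exact: iterint_ge0.
- exact: measurable_iterint.
Qed.

(** Permutations are generated by exchanges of adjacent blocks, and each exchange is an instance of
    Tonelli. *)
Lemma perm_iterint s1 s2 F : (forall t, 0 <= F t)%E -> measurable_fun setT F ->
  perm_eq s1 s2 -> iterint s1 F =1 iterint s2 F.
Proof.
move=> F0 mF; rewrite perm_sym => s12.
have swap u v w : iterint (u ++ v ++ w) F =1 iterint s2 F ->
    iterint (v ++ u ++ w) F =1 iterint s2 F; last first.
  exact: (@catCA_perm_ind _ (fun s => iterint s F =1 iterint s2 F)
    swap _ _ s12 (fun=> erefl)).
move=> uvw t; rewrite -uvw !iterint_cat; apply: iterintC.
- exact: iterint_ge0.
- exact: measurable_iterint.
Qed.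

Lemma iterintZl s (c : T -> R) F : (forall t, 0 <= F t)%E -> measurable_fun setT F ->
  (forall t, 0 <= c t) -> (forall t k x, k \in s -> c (upd t k x) = c t) ->
  iterint s (fun t => (c t)%:E * F t)%E =1 (fun t => (c t)%:E * iterint s F t)%E.
Proof.
move=> F0 mF c0; elim: s => //= k s IHs cs t.
have {}IHs : iterint s (fun t => (c t)%:E * F t)%E =1
    (fun t => (c t)%:E * iterint s F t)%E.
  by apply: IHs => u l x ls; rewrite cs// inE ls orbT.
rewrite (eq_int1 _ IHs) /int1.
under eq_integral do rewrite cs ?mem_head//.
have m1 := measurableT_comp (@measurable_iterint s _ F0 mF) (measurable_upd1 t k).
by rewrite ge0_integralZl_EFin// => x _; exact: iterint_ge0.
Qed.

Definition shift (c : nat -> R) t : T := [tuple tnth t j + c j | j < n].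

Lemma nth_shift c t k : (k < n)%N -> nth 0 (shift c t) k = nth 0 t k + c k.
Proof.
by move=> kn; rewrite -!(tnth_nth _ _ (Ordinal kn)) tnth_mktuple.
Qed.

Lemma upd_shift c t k x : upd (shift c t) k (x + c k) = shift c (upd t k x).
Proof.
apply/eq_from_tnth => j; rewrite !tnth_mktuple.
by case: eqP => // ->.
Qed.

(** Translation invariance for one coordinate of [s] at a time. Coordinates outside [s] are
    translated but not integrated, hence the [shift c] that remains on the right. *)
Lemma iterint_shift s c F : (forall t, 0 <= F t)%E -> measurable_fun setT F ->
  iterint s (F \o shift c) =1 iterint s F \o shift c.
Proof.
move=> F0 mF; elim: s => //= k s IHs t; rewrite (eq_int1 _ IHs) /int1/=.
under eq_integral do rewrite -upd_shift.
apply: (@ge0_integral_shift R (fun x => iterint s F (upd (shift c t) k x))).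
- exact: (measurableT_comp (@measurable_iterint s _ F0 mF) (measurable_upd1 _ k)).
- by move=> x; exact: iterint_ge0.
Qed.

Lemma iterint_congr s F G t :
  (forall t', (forall k, (k < n)%N -> k \notin s -> nth 0 t' k = nth 0 t k) ->
    F t' = G t') ->
  iterint s F t = iterint s G t.
Proof.
elim: s t => [|k s IHs] t FG /=; first exact: FG.
apply: eq_integral => x _; apply: IHs => t' tt'; apply: FG => l ln.
rewrite inE negb_or => /andP[lk ls]; rewrite tt'// nth_upd (negbTE lk)//.
Qed.

End tuples.

(** The base point [t] is arbitrary, since every coordinate gets overwritten. *)
Lemma integral_lebesgue_tuple n (F : n.-tuple RT -> \bar R) (t : n.-tuple RT) :
  (forall t, 0 <= F t)%E -> measurable_fun setT F ->
  (\int[lebesgue_tuple R n]_x F x)%E = iterint (iota 0 n) F t.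
Proof.
elim: n => [|n IHn] in F t *.
  move=> F0 mF /=; rewrite integral_dirac// diracT mul1e.
  by rewrite [t]tuple0.
move=> F0 mF /=; rewrite /int1.
have mc := @measurable_cons_pair R n.
have mFc : measurable_fun setT (F \o @cons_pair R n).
  exact: measurableT_comp mF mc.
transitivity (\int[(mu \x lebesgue_tuple R n)%E]_p (F \o @cons_pair R n) p)%E.
  by rewrite /cons_measure ge0_integral_pushforward ?preimage_setT// => ? _; exact: F0.
rewrite fubini_tonelli1//; last by move=> p; exact: F0.
apply: eq_integral => x _; rewrite /fubini_F.
pose tb : n.-tuple RT := [tuple of behead t].
have -> : upd t 0 x = cons_pair (x, tb).
  apply/eq_from_tnth => j; rewrite tnth_mktuple.
  case: (unliftP ord0 j) => [i|] ->//=.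
  by rewrite /cons_pair !(tnth_nth 0)/= nth_behead.
have F0c u : (0 <= (F \o @cons_pair R n) (x, u))%E by exact: F0.
rewrite (IHn _ tb F0c); last exact: measurableT_comp mFc (pair1_measurable x).
have iterS s u : iterint s (fun y => (F \o @cons_pair R n) (x, y)) u =
    iterint (map S s) F (cons_pair (x, u)).
  elim: s u => //= k s IHs u; apply: eq_integral => y _; rewrite IHs; congr iterint.
  apply/eq_from_tnth => j; rewrite [RHS]tnth_mktuple.
  case: (unliftP ord0 j) => [i|] ->//=.
  by rewrite /cons_pair !(tnth_nth 0)/= -(tnth_nth 0 (upd u k y)) tnth_mktuple -tnth_nth.
by rewrite (iotaDl 1 0 n : iota 1 n = _); exact: iterS.
Qed.

End IteratedIntegral.

(** * Schur complements and principal minors *)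

Section SchurComplement.
Variables (R : realType) (r : nat).
Implicit Types (v : 'I_r) (C D N : {set 'I_r}) (x y X : 'M[R]_r) (u : 'I_r -> R).

(** Schur complement at the pivot v. Row and column v are zeroed rather than deleted, so that the
    size and the names of the vertices never change. *)
Definition clear v x : 'M[R]_r :=
  \matrix_(i, j) if (i == v) || (j == v) then 0 else x i j - x i v * x v j / x v v.

(* The principal submatrix x_C, completed by an identity block outside C so that
   all sizes agree. *)
Definition mask C x : 'M[R]_r :=
  \matrix_(i, j) if (i \in C) && (j \in C) then x i j else (i == j)%:R.

Definition dt C x : R := \det (mask C x).

Definition qf C x u : R := \sum_(i in C) \sum_(j in C) u i * x i j * u j.

Definition pd C x : Prop :=
  forall u, (exists2 i, i \in C & u i != 0) -> 0 < qf C x u.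

Lemma clear_tr v x : x^T = x -> (clear v x)^T = clear v x.
Proof.
move=> xs; have xE i j : x i j = x j i by rewrite -[in LHS]xs mxE.
apply/matrixP => i j; rewrite !mxE orbC; case: ifP => // _.
by rewrite xE (xE j v) (xE v i) [x v j * _]mulrC.
Qed.

Let det_iso_row (W : 'M[R]_r) v : (forall j, j != v -> W v j = 0) ->
  \det W = W v v * cofactor W v v.
Proof.
move=> Wv; rewrite (expand_det_row _ v) (bigD1 v)//= big1 ?addr0// => j /Wv ->.
by rewrite mul0r.
Qed.

Let det_iso_col (W : 'M[R]_r) v : (forall i, i != v -> W i v = 0) ->
  \det W = W v v * cofactor W v v.
Proof.
move=> Wv; rewrite (expand_det_col _ v) (bigD1 v)//= big1 ?addr0// => j /Wv ->.
by rewrite mul0r.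
Qed.

Let eq_cofactor (W W' : 'M[R]_r) v :
  (forall i j, i != v -> j != v -> W i j = W' i j) ->
  cofactor W v v = cofactor W' v v.
Proof.
move=> WW'; rewrite /cofactor; congr (_ * \det _).
by apply/matrixP => i j; rewrite !mxE WW'// eq_sym neq_lift.
Qed.

Let cofactor1 v : cofactor (1%:M : 'M[R]_r) v v = 1.
Proof.
have := @det_iso_row 1%:M v; rewrite det1 !mxE eqxx mul1r => <- // j.
by rewrite !mxE eq_sym => /negbTE ->.
Qed.

Let cofactor_mask C x v : v \notin C -> cofactor (mask C x) v v = dt C x.
Proof.
move=> vC; rewrite /dt (@det_iso_row _ v).
  by rewrite [mask _ _ _ _]mxE (negbTE vC)/= eqxx mul1r.
by move=> j; rewrite mxE (negbTE vC)/= eq_sym => /negbTE ->.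
Qed.

Lemma dt_clear C x v : v \in C -> x v v != 0 ->
  dt C x = x v v * dt (C :\ v) (clear v x).
Proof.
move=> vC xv0; pose M := mask C x.
(* A unipotent column operation: multiples of column v are subtracted so as to clear the rest of row
   v, which leaves the Schur complement in the other rows. *)
pose V : 'M[R]_r := \matrix_(i, j)
  if i == v then (if j == v then 1 else - (M v j / M v v)) else (i == j)%:R.
have Mvv : M v v = x v v by rewrite !mxE vC.
have V1 : \det V = 1.
  rewrite (@det_iso_col _ v) ?(@eq_cofactor _ 1%:M) ?cofactor1 ?mxE ?eqxx ?mulr1//.
  - by move=> i j iv jv; rewrite !mxE (negbTE iv).
  - by move=> i iv; rewrite !mxE !(negbTE iv).
have MVE i j : (M *m V) i j = if j == v then M i v else M i j - M i v * (M v j / M v v).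
  rewrite mxE (bigD1 v)//= [V v j]mxE eqxx; case: eqP => [->|/eqP jv].
    rewrite big1 ?addr0 ?mulr1// => k kv.
    by rewrite [V _ _]mxE !(negbTE kv) mulr0.
  rewrite (bigD1 j)//= big1 ?addr0; last first.
    by move=> k /andP[kv kj]; rewrite [V _ _]mxE (negbTE kv) (negbTE kj) mulr0.
  by rewrite [V _ _]mxE (negbTE jv) eqxx mulr1 mulrN addrC.
have -> : dt C x = \det (M *m V) by rewrite det_mulmx V1 mulr1.
rewrite (@det_iso_row (M *m V) v); last first.
  by move=> j jv; rewrite MVE (negbTE jv) mulrCA divff ?Mvv// mulr1 subrr.
rewrite MVE eqxx Mvv; congr (_ * _).
rewrite -(@cofactor_mask (C :\ v) _ v) ?setD11//.
apply: eq_cofactor => i j iv jv; rewrite MVE (negbTE jv) Mvv !mxE !inE iv jv vC/=.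
rewrite (negbTE iv) eq_sym (negbTE jv) andbT [v == j]eq_sym (negbTE jv)/=.
case: (i \in C) => /=; last by rewrite mulr0n mul0r subr0.
case: (j \in C) => /=; first by rewrite [x i v * (_ / _)]mulrA.
by rewrite mulr0n mul0r mulr0 subr0.
Qed.

(* Cramer's rule: [l] is the column of index [v] of the inverse of [X_(v |: N)]. *)
Lemma dt_setU1 N X v (l : 'I_r -> R) : v \notin N ->
  (forall i, i \in v |: N -> \sum_(k in v |: N) X i k * l k = (i == v)%:R) ->
  dt (v |: N) X * l v = dt N X.
Proof.
move=> vN Xl; pose C := v |: N; pose M := mask C X.
have vC : v \in C by rewrite setU11.
(* The identity with column v replaced by [l]; multiplying by it replaces column v of [M] by a unit
   vector, as in the usual proof of Cramer's rule. *)
pose V : 'M[R]_r := \matrix_(i, j)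
  if j == v then (if i \in C then l i else 0) else (i == j)%:R.
have <- : \det V = l v.
  rewrite (@det_iso_row _ v) ?(@eq_cofactor _ 1%:M) ?cofactor1 ?mxE ?eqxx ?vC ?mulr1//.
  - by move=> i j iv jv; rewrite !mxE (negbTE jv).
  - by move=> j jv; rewrite !mxE (negbTE jv) eq_sym (negbTE jv).
have MVv i : (M *m V) i v = (i == v)%:R.
  rewrite mxE; under eq_bigr do rewrite [V _ _]mxE eqxx.
  have [iC|iC] := boolP (i \in C).
    rewrite -Xl// [RHS]big_mkcond/=; apply: eq_bigr => k _.
    by rewrite mxE iC/=; case: ifP => //; rewrite mulr0.
  have iv : i != v by apply: contraNneq iC => ->.
  rewrite (negbTE iv) big1// => k _; case: ifPn => kC; rewrite ?mulr0//.
  rewrite mxE (negbTE iC)/=.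
  by have -> : (i == k) = false; [apply: contraNF iC => /eqP ->|rewrite mul0r].
have MVE i j : j != v -> (M *m V) i j = M i j.
  move=> jv; rewrite mxE (bigD1 j)//= big1 ?addr0; last first.
    by move=> k kj; rewrite [V _ _]mxE (negbTE jv) (negbTE kj) mulr0.
  by rewrite [V _ _]mxE (negbTE jv) eqxx mulr1.
have -> : dt C X * \det V = \det (M *m V) by rewrite det_mulmx.
rewrite (@det_iso_col (M *m V) v); last first.
  by move=> i iv; rewrite MVv (negbTE iv).
rewrite MVv eqxx mul1r -(@cofactor_mask N X v)//.
apply: eq_cofactor => i j iv jv; rewrite MVE// !mxE !inE.
by rewrite (negbTE iv) (negbTE jv).
Qed.

(** Completing the square in the coordinate [u v]. This one identity drives both the pivot criterion
    [pd_clear] and the Gaussian integrals. *)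
Lemma qf_clear C x v u : x^T = x -> v \in C -> x v v != 0 ->
  qf C x u = x v v * (u v + (\sum_(i in C :\ v) x i v * u i) / x v v) ^+ 2
             + qf (C :\ v) (clear v x) u.
Proof.
move=> xs vC xv0; have xE i j : x i j = x j i by rewrite -[in LHS]xs mxE.
set b := \sum_(i in _) _.
have inE' (f : 'I_r -> R) : \sum_(i in C) f i = f v + \sum_(i in C :\ v) f i.
  by rewrite (big_setD1 v).
have -> : qf C x u = u v * x v v * u v + 2 * (u v * b) +
    \sum_(i in C :\ v) \sum_(j in C :\ v) u i * x i j * u j.
  rewrite /qf inE' inE'; under [in X in _ + X]eq_bigr do rewrite inE'.
  have -> : \sum_(j in C :\ v) u v * x v j * u j = u v * b.
    by rewrite mulr_sumr; apply: eq_bigr => j _; rewrite xE; ring.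
  rewrite big_split/=.
  have -> : \sum_(i in C :\ v) u i * x i v * u v = u v * b.
    by rewrite mulr_sumr; apply: eq_bigr => j _; ring.
  by ring.
have -> : qf (C :\ v) (clear v x) u =
    \sum_(i in C :\ v) \sum_(j in C :\ v) u i * x i j * u j - b ^+ 2 / x v v.
  rewrite expr2 {1}/b mulr_suml mulr_suml -sumrB; apply: eq_bigr => i iC.
  rewrite /b mulr_sumr mulr_suml -sumrB; apply: eq_bigr => j jC.
  move: iC jC; rewrite !inE => /andP[/negbTE iv _] /andP[/negbTE jv _].
  by rewrite mxE iv jv/= (xE v j); ring.
by field.
Qed.

Lemma pd_clear C x v : x^T = x -> v \in C ->
  pd C x <-> 0 < x v v /\ pd (C :\ v) (clear v x).
Proof.
move=> xs vC; split.
- move=> pdx; have xv0 : 0 < x v v.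
    have := pdx (fun i => (i == v)%:R); rewrite /qf (big_setD1 v)//= (big_setD1 v)//=.
    rewrite !big1 ?eqxx ?mul1r ?mulr1 ?addr0.
    + by apply; exists v; rewrite ?eqxx ?oner_eq0.
    + move=> i; rewrite !inE => /andP[/negbTE iv _].
      by rewrite iv big1// => j _; rewrite !mul0r.
    + by move=> j; rewrite !inE => /andP[/negbTE jv _]; rewrite jv mulr0.
  split=> // u [i iC ui0]; move: (iC); rewrite inE => /andP[iv iC'].
  (* Choosing -b as the coordinate at v makes the completed square vanish, so only the form of the
     Schur complement is left. *)
  pose b := (\sum_(i in C :\ v) x i v * u i) / x v v.
  pose u' j := if j == v then - b else u j.
  have u'E j : j \in C :\ v -> u' j = u j.
    by rewrite !inE /u' => /andP[/negbTE ->].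
  have := pdx u'; rewrite (@qf_clear _ _ v)// ?gt_eqF//.
  rewrite (eq_bigr (fun i => x i v * u i)); last by move=> j /u'E ->.
  rewrite -/b (_ : u' v = - b) ?addNr; last by rewrite /u' eqxx.
  rewrite expr0n mulr0 add0r.
  rewrite (_ : qf _ _ u' = qf (C :\ v) (clear v x) u); last first.
    by apply: eq_bigr => j /u'E ->; apply: eq_bigr => k /u'E ->.
  by apply; exists i => //; rewrite u'E.
- move=> [xv0 pdx] u [i iC ui0]; rewrite (@qf_clear _ _ v)// ?gt_eqF//.
  have [/exists_inP h|/exists_inPn h] := boolP [exists j in C :\ v, u j != 0].
    by rewrite ltr_wpDl ?pdx// mulr_ge0 ?sqr_ge0// ltW.
  have {}h j : j \in C :\ v -> u j = 0 by move=> /h; rewrite negbK => /eqP.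
  have iv : i = v.
    by apply: contraNeq ui0 => iv; rewrite h// !inE iv.
  rewrite big1 ?mul0r ?addr0; last by move=> j /h ->; rewrite mulr0.
  rewrite [qf _ _ _]big1 ?addr0; last first.
    by move=> j /h ->; rewrite big1// => k _; rewrite !mul0r.
  by rewrite -iv mulr_gt0 ?iv// lt0r sqr_ge0 sqrf_eq0 -iv ui0.
Qed.

Lemma dt_set0 x : dt finset.set0 x = 1.
Proof.
rewrite /dt (_ : mask _ _ = 1%:M) ?det1//.
by apply/matrixP => i j; rewrite !mxE !inE.
Qed.

Lemma pd_dt_gt0 C x : x^T = x -> pd C x -> 0 < dt C x.
Proof.
have [n] := ubnP #|C|; elim: n C x => // n IHn C x Cn xs pdx.
have [->|[v vC]] := set_0Vmem C; first by rewrite dt_set0.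
have [xv0 pdc] := (pd_clear xs vC).1 pdx.
rewrite (dt_clear vC) ?gt_eqF// mulr_gt0// IHn//; last exact: clear_tr.
by rewrite (cardsD1 v) vC ltnS in Cn.
Qed.

Lemma pd_subset C D x : C \subset D -> pd D x -> pd C x.
Proof.
move=> CD pdx u [i iC ui]; pose u' j := if j \in C then u j else 0.
have -> : qf C x u = qf D x u'.
  rewrite /qf [LHS]big_mkcond [RHS]big_mkcond/=; apply: eq_bigr => j _.
  have [jC|jC] := boolP (j \in C); last first.
    by case: ifP => // _; rewrite big1// => k _; rewrite /u' (negbTE jC) !mul0r.
  rewrite (fintype.subsetP CD)// [LHS]big_mkcond [RHS]big_mkcond/=.
  apply: eq_bigr => k _; rewrite /u' jC.
  have [kC|kC] := boolP (k \in C); first by rewrite (fintype.subsetP CD).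
  by case: ifP => //; rewrite mulr0.
by apply: pdx; exists i; rewrite /u' ?iC// (fintype.subsetP CD).
Qed.

Lemma eq_dt C x y : {in C &, forall i j, x i j = y i j} -> dt C x = dt C y.
Proof.
move=> xy; congr (\det _); apply/matrixP => i j; rewrite !mxE.
by case: ifP => // /andP[iC jC]; exact: xy.
Qed.

Let det_mxsub_inj m n (A : 'M[R]_n) (f : 'I_m -> 'I_n) : m = n -> injective f ->
  \det (mxsub f f A) = \det A.
Proof.
move=> mn; case: _ / (esym mn) f => f finj.
have -> : mxsub f f A = row_perm (perm finj) (col_perm (perm finj) A).
  by apply/matrixP => i j; rewrite !mxE !permE.
rewrite row_permE col_permE !det_mulmx !det_perm odd_permV mulrCA -expr2.
by rewrite sqrr_sign mulr1.
Qed.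

Lemma det_princ_mx C x : \det (princ_mx C x) = dt C x.
Proof.
(* Lists the vertices of C first and the others after them, which makes the masked matrix block
   diagonal. Its index type has r elements only up to a proved equality, hence the form of
   [det_mxsub_inj]. *)
pose f (i : 'I_(#|C| + #|~: C|)) : 'I_r :=
  match fintype.split i with inl a => enum_val a | inr b => enum_val b end.
have cC : (#|C| + #|~: C|)%N = r by rewrite cardsC card_ord.
have fl a : f (lshift _ a) = enum_val a by rewrite /f (unsplitK (inl a)).
have fr b : f (rshift _ b) = enum_val b by rewrite /f (unsplitK (inr b)).
have frC b : (f (rshift _ b) \in C) = false.
  by apply/negbTE; rewrite fr; have := enum_valP b; rewrite inE.
have flC a : f (lshift _ a) \in C by rewrite fl enum_valP.
have finj : injective f.
  move=> i j; case: (split_ordP i) => a ->; case: (split_ordP j) => b ->.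
  - by rewrite !fl => /enum_val_inj ->.
  - by move=> ab; have := flC a; rewrite ab frC.
  - by move=> ab; have := flC b; rewrite -ab frC.
  - by rewrite !fr => /enum_val_inj ->.
rewrite /dt -(det_mxsub_inj (mask C x) cC finj).
have -> : mxsub f f (mask C x) = block_mx (princ_mx C x) 0 0 1%:M.
  apply/matrixP => i j; case: (split_ordP i) => a ->; case: (split_ordP j) => b ->.
  - by rewrite block_mxEul !mxE !flC/= !fl.
  - by rewrite block_mxEur !mxE frC andbF (inj_eq finj) eq_lrshift.
  - by rewrite block_mxEdl !mxE frC/= (inj_eq finj) eq_rlshift.
  - by rewrite block_mxEdr !mxE frC/= (inj_eq finj) eq_rshift.
by rewrite det_ublock det1 mulr1.
Qed.

Let quadE n (M : 'M[R]_n) (u : 'rV[R]_n) :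
  (u *m M *m u^T) 0 0 = \sum_i \sum_j u 0 i * M i j * u 0 j.
Proof.
rewrite mxE exchange_big/=; apply: eq_bigr => j _.
by rewrite !mxE mulr_suml.
Qed.

Lemma posdef_princ_mx C x : posdef (princ_mx C x) -> pd C x.
Proof.
move=> [_ pdx] u [i iC ui].
pose w : 'rV_#|C| := \row_a u (enum_val a).
have -> : qf C x u = (w *m princ_mx C x *m w^T) 0 0.
  rewrite quadE /qf big_enum_val/=; apply: eq_bigr => a _.
  by rewrite big_enum_val/=; apply: eq_bigr => b _; rewrite !mxE.
apply: pdx; apply: contra_neq ui => /rowP/(_ (enum_rank_in iC i)).
by rewrite !mxE enum_rankK_in.
Qed.

Lemma qf_setT x u : qf [set: 'I_r]%SET x u = \sum_i \sum_j u i * x i j * u j.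
Proof.
by apply: eq_big => [i|i _]; rewrite ?inE//; apply: eq_bigl => j; rewrite inE.
Qed.

Lemma posdefE x : posdef x <-> x^T = x /\ pd [set: 'I_r]%SET x.
Proof.
split=> -[xs pdx]; split => // u.
- move=> [i _ ui]; pose w : 'rV_r := \row_a u a.
  have -> : qf [set: 'I_r]%SET x u = (w *m x *m w^T) 0 0.
    rewrite quadE qf_setT; apply: eq_bigr => a _.
    by apply: eq_bigr => b _; rewrite !mxE.
  by apply: pdx; apply: contra_neq ui => /rowP/(_ i); rewrite !mxE.
- move=> /rV0Pn[i ui]; rewrite quadE.
  by have := pdx (fun i => u 0 i); rewrite qf_setT; apply; exists i; rewrite ?inE.
Qed.

Lemma posdef_unitmx x : posdef x -> x \in unitmx.
Proof.
move=> /posdefE[xs pdx]; have := pd_dt_gt0 xs pdx.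
rewrite unitmxE unitfE /dt (_ : mask _ x = x); first exact: lt0r_neq0.
by apply/matrixP => i j; rewrite !mxE !inE.
Qed.

Lemma posdef_invmx x : posdef x -> posdef (invmx x).
Proof.
move=> px; have xu := posdef_unitmx px; case: px => xs pdx.
have xVs : (invmx x)^T = invmx x by rewrite trmx_inv xs.
split=> // u u0; have := pdx (u *m invmx x).
rewrite trmx_mul xVs mulmxKV// mulmxA; apply.
by apply: contra_neq u0 => u0; rewrite -[u](mulmxKV xu) u0 mul0mx.
Qed.

(* [X] is a left inverse of [y] on the set [C] of remaining vertices, hence still
   one of the Schur complement once [v] is eliminated. *)
Definition linv_on C X y : Prop :=
  {in C &, forall i j, \sum_(k in C) X i k * y k j = (i == j)%:R}.

(** Column j of y loses a multiple of column v, whose product with row i of X is 0 for i != v; the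
    term k = v that disappears from the sum is zero after this operation. *)
Lemma linv_on_clear C X y v : v \in C -> y v v != 0 -> linv_on C X y ->
  linv_on (C :\ v) X (clear v y).
Proof.
move=> vC yv0 Xy i j /setD1P[iv iC] /setD1P[jv jC].
have sumE l : l \in C -> \sum_(k in C :\ v) X i k * y k l = (i == l)%:R - X i v * y v l.
  by move=> lC; rewrite -Xy// [in RHS](big_setD1 v)//= addrAC subrr add0r.
transitivity (\sum_(k in C :\ v) (X i k * y k j - X i k * y k v * (y v j / y v v))).
  apply: eq_bigr => k /setD1P[kv _]; rewrite mxE (negbTE kv) (negbTE jv)/=.
  by ring.
rewrite sumrB -mulr_suml !sumE// (negbTE iv) mulr0n sub0r.
by field.
Qed.

End SchurComplement.

(** * Elimination of vertices *)

Section EdgeCoordinates.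
Variables (R : realType) (r : nat) (e : rel 'I_r).
Hypothesis e_sym : symmetric e.
Local Notation RT := (measurableTypeR R).
Local Notation n := #|edge_coords e|.
Local Notation mx := (@mx_of_coords R r e).
Implicit Types (i j k l : 'I_r) (t : n.-tuple RT).

Definition edge_index i j : nat :=
  index (if (i <= j)%N then (i, j) else (j, i)) (enum (edge_coords e)).

Local Notation ix := edge_index.

Lemma mxE_ix t i j : mx t i j = nth 0 t (ix i j).
Proof. by rewrite mxE. Qed.

Lemma ixC i j : ix i j = ix j i.
Proof. by rewrite /edge_index; case: ltngtP => // /val_inj ->. Qed.

Lemma mem_edge_coords i j :
  ((if (i <= j)%N then (i, j) else (j, i)) \in enum (edge_coords e)) = e i j.
Proof.
by rewrite mem_enum inE; have [h|/ltnW h] := leqP i j; rewrite /= h//=.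
Qed.

Lemma ix_lt i j : (ix i j < n)%N = e i j.
Proof. by rewrite /edge_index cardE index_mem mem_edge_coords. Qed.

Lemma ix_inj i j k l : e i j -> ix i j = ix k l ->
  (k = i /\ l = j) \/ (k = j /\ l = i).
Proof.
move=> ij ijkl; have kl : e k l by rewrite -ix_lt -ijkl ix_lt.
rewrite -mem_edge_coords in ij; rewrite -mem_edge_coords in kl.
have := index_inj (i, j) ij kl ijkl.
by case: ifP => _; case: ifP => _ [-> ->]; [left|right|right|left].
Qed.

Lemma mx_sym t i j : mx t i j = mx t j i.
Proof. by rewrite !mxE_ix ixC. Qed.

Lemma mx_tr t : (mx t)^T = mx t.
Proof. by apply/matrixP => i j; rewrite mxE mx_sym. Qed.

Lemma mx_nonedge t i j : ~~ e i j -> mx t i j = 0.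
Proof.
by rewrite -ix_lt -leqNgt mxE_ix => h; rewrite nth_default// size_tuple.
Qed.

Lemma mx_upd t i j (k : nat) (x : R) : mx (upd t k x) i j =
  if (ix i j == k) && e i j then x else mx t i j.
Proof. by rewrite !mxE_ix nth_upd ix_lt. Qed.

Lemma measurable_mx i j : measurable_fun [set: n.-tuple RT] (fun t => mx t i j).
Proof. by under eq_fun do rewrite mxE_ix; exact: measurable_nth. Qed.

Lemma mx_shift (f : 'I_r -> 'I_r -> R) p0 t i j : (forall i j, f i j = f j i) ->
  e i j ->
  mx (shift (fun k : nat => let p := nth p0 (enum (edge_coords e)) k in f p.1 p.2) t) i j
  = mx t i j + f i j.
Proof.
move=> fs ij; rewrite !mxE_ix nth_shift ?ix_lt//; congr (_ + _).
by rewrite /edge_index nth_index ?mem_edge_coords//=; case: ifP.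
Qed.

End EdgeCoordinates.

Section Elimination.
Variables (R : realType) (r : nat) (e : rel 'I_r).
Hypotheses (e_refl : reflexive e) (e_sym : symmetric e).
Local Notation RT := (measurableTypeR R).
Local Notation n := #|edge_coords e|.
Local Notation mx := (@mx_of_coords R r e).
Local Notation ix := (edge_index e).
Local Notation mu := (@lebesgue_measure R).

(* In an entry (v, N, a) of an elimination list, N is the set of neighbours of v
   among the vertices further down the list, which are eliminated after v, and a
   is the exponent of |x_(v |: N)| / |x_N| in the integrand. *)
Local Notation elim := (seq ('I_r * {set 'I_r} * R)).
Implicit Types (L : elim) (v : 'I_r) (N : {set 'I_r}) (y : 'M[R]_r) (t : n.-tuple RT).

Definition vtx L : seq 'I_r := [seq q.1.1 | q <- L].

Fixpoint wf L : Prop :=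
  if L is (v, N, _) :: L' then
    [/\ v \notin vtx L', N = [set u in vtx L' | e u v]%SET, complete_in e N & wf L']
  else True.

(** [iterint] integrates the end of a list first: everything beyond row v at fixed row v, then the
    off-diagonal entries of row v at fixed pivot, then the pivot. *)
Fixpoint ecoords L : seq nat :=
  if L is (v, N, _) :: L' then
    ix v v :: [seq ix v u | u <- enum N] ++ ecoords L'
  else [::].

Variable theta : 'M[R]_r.
Hypothesis theta_sym : theta^T = theta.
Hypothesis theta_pd : forall C : {set 'I_r}, complete_in e C -> pd C theta.

(** The quadratic form is the share of <theta, y> carried by the rank-one matrix that [clear v]
    subtracts. The exponent is -a because |x_(v |: N)| / |x_N| is the inverse of the pivot. The
    value 0 at a nonpositive pivot confines [density] to P_G. *)
Definition factor v N (a : R) y : R :=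
  if 0 < y v v then
    y v v `^ (- a) * expR (- ((y v v)^-1 * qf (v |: N) theta (fun i => y i v)))
  else 0.

Fixpoint density L y : R :=
  if L is (v, N, a) :: L' then factor v N a y * density L' (clear v y) else 1.

(** The Gaussian integral in b at pivot t gives (pi t)^(|N|/2) |theta_N|^(-1/2) and leaves exp(-t
    d), with d = |theta_(v |: N)| / |theta_N|. Together with t^(-a) the power of t is p - 1, whence
    Gamma(p) d^(-p). *)
Definition gconst (q : 'I_r * {set 'I_r} * R) : R :=
  let: (v, N, a) := q in let p := #|N|%:R / 2 - a + 1 in
  pi `^ (#|N|%:R / 2) * dt N theta `^ (- 2^-1) *
  (Gamma p * (dt (v |: N) theta / dt N theta) `^ (- p)).

Lemma factor_ge0 v N a y : 0 <= factor v N a y.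
Proof.
by rewrite /factor; case: ifP => // _; rewrite mulr_ge0 ?powR_ge0 ?expR_ge0.
Qed.

Lemma density_ge0 L y : 0 <= density L y.
Proof.
by elim: L y => //= -[[v N] a] L IHL y; rewrite mulr_ge0// factor_ge0.
Qed.

Section measurable.
Context d (T : measurableType d).
Implicit Type Y : T -> 'M[R]_r.

Let mentries Y := forall i j, measurable_fun [set: T] (fun w => Y w i j).

Let minv (f : T -> R) : measurable_fun setT f ->
  measurable_fun setT (fun w => (f w)^-1).
Proof.
(* The inverse, with value 0 at 0, is a power of exponent -1 on each side of 0. *)
move=> mf; rewrite (_ : (fun w => _) = (fun w => if 0 < f w then f w `^ (-1) else
    if f w < 0 then - ((- f w) `^ (-1)) else 0)).
  have mN : measurable_fun setT (fun w => - f w) by exact: measurable_funN.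
  apply: measurable_fun_ifT; first exact: measurable_fun_ltr.
    exact: measurableT_comp (measurable_powR _) mf.
  apply: measurable_fun_ifT => //; first exact: measurable_fun_ltr.
  apply: measurable_funN.
  exact: measurableT_comp (measurable_powR _) mN.
apply/funext => w; have [fw|fw|<-] := ltgtP 0 (f w); last by rewrite invr0.
- by rewrite powR_inv1// ltW.
- by rewrite powR_inv1 ?invrN ?opprK// oppr_ge0 ltW.
Qed.

Let msum (I : finType) (P : pred I) (f : I -> T -> R) :
  (forall i, measurable_fun setT (f i)) ->
  measurable_fun setT (fun w => \sum_(i | P i) f i w).
Proof.
move=> mf; under eq_fun do rewrite -big_filter.
exact: measurable_sum.
Qed.

Lemma measurable_factor v N a Y : mentries Y ->
  measurable_fun setT (fun w => factor v N a (Y w)).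
Proof.
move=> mY; apply: measurable_fun_ifT => //; first exact: measurable_fun_ltr.
apply: measurable_funM; first exact: measurableT_comp (measurable_powR _) (mY _ _).
apply: measurableT_comp => //; apply: measurable_funN; apply: measurable_funM.
  exact: minv.
apply: msum => i; apply: msum => j; apply: measurable_funM => //.
by apply: measurable_funM.
Qed.

Lemma measurable_clear v Y : mentries Y -> mentries (fun w => clear v (Y w)).
Proof.
move=> mY i j; under eq_fun do rewrite mxE.
case: (_ || _); first exact: measurable_cst.
apply: measurable_funB => //.
by apply: measurable_funM; [exact: measurable_funM|exact: minv].
Qed.

Lemma measurable_density L Y : mentries Y ->
  measurable_fun setT (fun w => density L (Y w)).
Proof.
elim: L Y => //= -[[v N] a] L IHL Y mY.
apply: measurable_funM; first exact: measurable_factor.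
exact/IHL/measurable_clear.
Qed.

End measurable.

Let mdensity L : measurable_fun setT (fun t => (density L (mx t))%:E).
Proof. by apply/measurable_EFinP/measurable_density => i j; exact: measurable_mx. Qed.

Lemma mem_vtx_wf v N a L : wf ((v, N, a) :: L) ->
  forall u, u \in N -> (u \in vtx L) && (u != v).
Proof.
move=> [vL -> _ _] u; rewrite inE => /andP[uL _]; rewrite uL.
by apply: contraNneq vL => <-.
Qed.

Lemma eq_density L y y' : wf L ->
  {in vtx L &, forall i j, y i j = y' i j} -> density L y = density L y'.
Proof.
elim: L y y' => //= -[[v N] a] L IHL y y' wfL yy'.
have vv : y v v = y' v v by rewrite yy' ?mem_head.
have inL i : i \in v |: N -> i \in v :: vtx L.
  rewrite !inE => /orP[/eqP ->|iN]; first by rewrite eqxx.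
  by have /andP[-> _] := @mem_vtx_wf v N a L wfL i iN; rewrite orbT.
congr (_ * _).
  rewrite /factor vv (_ : qf _ _ (fun i => y i v) = qf (v |: N) theta (fun i => y' i v))//.
  by apply: eq_bigr => i /inL iL; apply: eq_bigr => j /inL jL; rewrite !yy' ?mem_head.
case: (wfL) => vL _ _ /IHL; apply => i j iL jL; rewrite !mxE.
by rewrite vv !yy' ?mem_head ?inE ?iL ?jL ?orbT.
Qed.

Lemma mem_ecoords L k : wf L -> k \in ecoords L ->
  exists i j, [/\ i \in vtx L, j \in vtx L, e i j & k = ix i j].
Proof.
elim: L => //= -[[v N] a] L IHL wfL.
have [vL NE cN] : [/\ v \notin vtx L, N = [set u in vtx L | e u v]%SET,
  complete_in e N & wf L] := wfL => wfL'.
rewrite inE mem_cat => /orP[/eqP ->|/orP[/mapP[u uN ->]|/IHL[]// i [j [iL jL eij ->]]]].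
- by exists v, v; rewrite mem_head e_refl.
- rewrite mem_enum in uN; exists v, u; rewrite mem_head inE.
  have /andP[-> _] := @mem_vtx_wf v N a L wfL u uN; rewrite orbT; split => //.
  by move: uN; rewrite NE inE e_sym => /andP[].
- by exists i, j; rewrite !inE iL jL !orbT.
Qed.

Lemma ecoords_ix L i j : wf L -> i \in vtx L -> j \in vtx L -> e i j ->
  ix i j \in ecoords L.
Proof.
elim: L i j => //= -[[v N] a] L IHL i j [vL NE cN wfL'].
have Nv u : u \in vtx L -> e u v -> ix v u \in [seq ix v u | u <- enum N].
  by move=> uL uv; apply: map_f; rewrite mem_enum NE inE uL.
rewrite !inE mem_cat => /orP[/eqP ->|iL] /orP[/eqP ->|jL] eij.
- by rewrite eqxx.
- by rewrite Nv ?orbT// e_sym.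
- by rewrite ixC Nv ?orbT.
- by rewrite IHL ?orbT.
Qed.

Lemma ix_notin v i L : wf L -> v \notin vtx L -> e v i -> ix v i \notin ecoords L.
Proof.
move=> wfL vL evi; apply/negP => /(mem_ecoords wfL)[k [l [kL lL ekl]]].
by move=> /(ix_inj e_sym evi)[] [kE lE]; move: vL; rewrite -?kE -?lE ?kL ?lL.
Qed.

Lemma uniq_ecoords L : wf L -> uniq (ecoords L).
Proof.
elim: L => //= -[[v N] a] L IHL wfL.
have [vL NE cN] : [/\ v \notin vtx L, N = [set u in vtx L | e u v]%SET,
  complete_in e N & wf L] := wfL => wfL'.
have evN u : u \in N -> e v u by rewrite NE inE e_sym => /andP[].
rewrite cons_uniq mem_cat negb_or ix_notin ?e_refl// andbT cat_uniq IHL// andbT.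
apply/and3P; split.
- apply/mapP => -[u]; rewrite mem_enum => uN /(ix_inj e_sym (e_refl v)).
  by have /andP[_ /eqP uv] := @mem_vtx_wf v N a L wfL u uN; case=> -[].
- rewrite map_inj_in_uniq ?enum_uniq// => u w; rewrite !mem_enum => uN wN.
  move=> /(ix_inj e_sym (evN _ uN)) [] [] // wu uw.
  by rewrite -wu.
- apply/hasPn => k kL; apply/mapP => -[u]; rewrite mem_enum => uN kE.
  by move: kL; rewrite kE (negbTE (ix_notin _ _ _))// evN.
Qed.

Lemma perm_ecoords L : wf L -> vtx L =i 'I_r -> perm_eq (iota 0 n) (ecoords L).
Proof.
move=> wfL VL; apply: uniq_perm; rewrite ?iota_uniq ?uniq_ecoords// => k.
rewrite mem_iota add0n leq0n/=; apply/idP/idP => [kn|/(mem_ecoords wfL)].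
  rewrite cardE in kn.
  case E : (enum (edge_coords e)) kn => [//|p0 s].
  rewrite -E => kn; pose p := nth p0 (enum (edge_coords e)) k.
  have : p \in enum (edge_coords e) by exact: mem_nth.
  rewrite mem_enum inE => /andP[p12 ep].
  have -> : k = ix p.1 p.2.
    by rewrite /edge_index p12 -surjective_pairing index_uniq// enum_uniq.
  by apply: ecoords_ix; rewrite ?VL.
by move=> [i [j [_ _ eij ->]]]; rewrite (ix_lt e_sym).
Qed.

Let measurable_qf C (A : 'M[R]_r) v :
  measurable_fun setT (fun t => qf C A (fun i => mx t i v)).
Proof.
have mi i := @measurable_mx R r e i v.
rewrite /qf; under eq_fun do rewrite -big_filter.
apply: measurable_sum => i; under eq_fun do rewrite -big_filter.
apply: measurable_sum => j; apply: measurable_funM => //.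
exact: measurable_funM.
Qed.

Lemma iterint_gauss (ns : seq 'I_r) v (A : 'M[R]_r) (x : R) t :
  A^T = A -> uniq ns -> v \notin ns -> {in ns, forall u, e v u} ->
  pd (v |: [set u in ns]%SET) A -> 0 < x -> mx t v v = x ->
  iterint [seq ix v u | u <- ns] (fun t => (expR (- (x^-1 *
    qf (v |: [set u in ns]%SET) A (fun i => mx t i v))))%:E) t =
  ((pi * x) `^ ((size ns)%:R / 2) * dt [set u in ns]%SET A `^ (- 2^-1) *
   expR (- (x * (dt (v |: [set u in ns]%SET) A / dt [set u in ns]%SET A))))%:E.
Proof.
(* Induction from the right, since the last index of the list is the innermost integral. *)
elim/last_ind: ns A t => [|ns u IHns] A t As + + evns + x0 tx.
  rewrite (_ : [set u in [::]]%SET = finset.set0); last by apply/setP => i; rewrite !inE.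
  rewrite finset.setU0 => _ _ pdA.
  have [Avv0 _] := (pd_clear As (set11 v)).1 pdA.
  rewrite /= dt_set0 powR1 mul0r powRr0 !mul1r divr1.
  rewrite (dt_clear (set11 v)) ?gt_eqF// finset.setDv dt_set0 mulr1.
  rewrite /qf !big_set1 tx; congr (expR (- _))%:E.
  by field; rewrite gt_eqF.
rewrite rcons_uniq mem_rcons inE negb_or => /andP[uns uniq_ns] /andP[vu vns] pdA.
pose N := [set i in ns]%SET.
have NE : [set i in rcons ns u]%SET = u |: N.
  by apply/setP => i; rewrite !inE mem_rcons inE.
have uvN : (v |: [set i in rcons ns u]%SET) :\ u = v |: N.
  apply/setP => i; rewrite NE !inE; have [->|//] := eqVneq i u.
  by rewrite eq_sym (negbTE vu) (negbTE uns).
have uN : (u |: N) :\ u = N.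
  apply/setP => i; rewrite !inE; have [->|//] := eqVneq i u.
  by rewrite (negbTE uns).
have uS : u \in v |: [set i in rcons ns u]%SET by rewrite NE !inE eqxx orbT.
have [Auu0 pdA'] := (pd_clear As uS).1 pdA; rewrite uvN in pdA'.
have evu : e v u by apply: evns; rewrite mem_rcons mem_head.
have evns' : {in ns, forall w, e v w}.
  by move=> w wns; apply: evns; rewrite mem_rcons inE wns orbT.
rewrite map_rcons -cats1 iterint_cat.
pose c := Num.sqrt (pi / (x^-1 * A u u)).
pose G t' := (expR (- (x^-1 * qf (v |: N) (clear u A) (fun i => mx t' i v)))).
rewrite (@eq_iterint _ _ _ _ (fun t' => (c%:E * (G t')%:E)%E)); last first.
  move=> t' /=; rewrite /int1.
  transitivity (\int[mu]_z ((G t')%:E * (expR (- ((x^-1 * A u u) * (z +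
      (\sum_(i in v |: N) A i u * mx t' i v) / A u u) ^+ 2)))%:E))%E.
    apply: eq_integral => z _; rewrite -EFinM -expRD; congr (expR _)%:E.
    have E1 i : i != u -> mx (upd t' (ix v u) z) i v = mx t' i v.
      move=> iu; rewrite (mx_upd e_sym); case: ifPn => // /andP[/eqP h ei].
      have := ix_inj e_sym ei h; case=> -[_ E3]; first by rewrite E3 eqxx in vu.
      by rewrite E3 eqxx in iu.
    have E2 : mx (upd t' (ix v u) z) u v = z.
      by rewrite (mx_upd e_sym) ixC eqxx e_sym evu.
    rewrite (qf_clear _ As uS) ?gt_eqF// uvN E2.
    have -> : qf (v |: N) (clear u A) (fun i => mx (upd t' (ix v u) z) i v) =
        qf (v |: N) (clear u A) (fun i => mx t' i v).
      have neu i : i \in v |: N -> i != u.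
        by rewrite -uvN !inE => /andP[].
      by apply: eq_bigr => i /neu iu; apply: eq_bigr => j /neu ju; rewrite !E1.
    rewrite (eq_bigr (fun i => A i u * mx t' i v)); last first.
      by move=> i; rewrite -uvN => /setD1P[iu _]; rewrite E1.
    by rewrite -/N; ring.
  have k0 : 0 < x^-1 * A u u by rewrite mulr_gt0// invr_gt0.
  rewrite ge0_integralZl_EFin//; last 2 first.
  - apply/measurable_EFinP; apply: measurableT_comp => //.
    apply: measurable_funN; apply: measurable_funM => //.
    by apply: measurable_funX; exact: measurable_funD.
  - exact: expR_ge0.
  by rewrite integral_gauss_affine// muleC.
have mG : measurable_fun setT (EFin \o G).
  apply/measurable_EFinP; apply: measurableT_comp => //.
  by apply: measurable_funN; exact: measurable_funM.
have c0 : 0 <= c by exact: sqrtr_ge0.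
rewrite (@iterintZl _ _ _ (fun=> c) (EFin \o G))//; last first.
  by move=> t'; rewrite lee_fin expR_ge0.
rewrite /= /G IHns//; last exact: clear_tr.
rewrite -EFinM; congr (_%:E); rewrite -/N NE size_rcons.
rewrite NE in uS uvN.
have pdN : pd N (clear u A).
  by apply: pd_subset pdA'; exact: finset.subsetUr.
have dN := pd_dt_gt0 (clear_tr u As) pdN.
have dvN := pd_dt_gt0 (clear_tr u As) pdA'.
rewrite (dt_clear uS) ?gt_eqF// uvN.
rewrite (@dt_clear _ _ (u |: N) A u) ?setU11 ?gt_eqF// uN.
(* The rate of the remaining exponential is unaffected: both minors contain the same pivot
   [A u u]. *)
have -> : A u u * dt (v |: N) (clear u A) / (A u u * dt N (clear u A)) =
    dt (v |: N) (clear u A) / dt N (clear u A).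
  by field; rewrite !gt_eqF.
rewrite !mulrA; congr (_ * _); rewrite (powRM _ (ltW Auu0) (ltW dN)) !mulrA.
congr (_ * _).
have px : 0 < pi * x by rewrite mulr_gt0// pi_gt0.
rewrite [RHS](_ : _ = (pi * x) `^ ((size ns)%:R / 2) *
   ((pi * x) `^ 2^-1 * A u u `^ (- 2^-1))); last first.
  rewrite mulrA -powRD; last by rewrite (gt_eqF px) implybT.
  by congr (_ `^ _ * _); rewrite -addn1 natrD mulrDl mul1r.
rewrite mulrC; congr (_ * _); rewrite /c.
have -> : pi / (x^-1 * A u u) = pi * x * (A u u)^-1.
  by move: pi => q; field; rewrite !gt_eqF.
have Ai : 0 <= (A u u)^-1 by rewrite invr_ge0 ltW.
rewrite -(powR12_sqrt (mulr_ge0 (ltW px) Ai)) (powRM _ (ltW px) Ai); congr (_ * _).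
by rewrite -powR_inv1 ?ltW// -powRrM mulN1r.
Qed.

(* On the edges between the remaining vertices, eliminating v is a translation by
   quantities which depend on the row v only. *)
Lemma iterint_clear v N a L t : wf ((v, N, a) :: L) ->
  iterint (ecoords L) (fun t => (density L (clear v (mx t)))%:E) t =
  iterint (ecoords L) (fun t => (density L (mx t))%:E) (shift (fun k : nat =>
    let p := nth (v, v) (enum (edge_coords e)) k in
    - (mx t p.1 v * mx t p.2 v / mx t v v)) t).
Proof.
move=> wfL.
have [vL NE cN] : [/\ v \notin vtx L, N = [set u in vtx L | e u v]%SET,
  complete_in e N & wf L] := wfL => wfL'.
set c := (fun k : nat => _).
have d0 t' : (0 <= (density L (mx t'))%:E)%E by rewrite lee_fin density_ge0.
etransitivity; last exact: (iterint_shift (ecoords L) c d0 (mdensity L) t).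
apply: iterint_congr => t' tt' /=; congr (_%:E); apply: eq_density => // i j iL jL.
have rowv u : mx t' u v = mx t u v.
  have [euv|euv] := boolP (e u v); last by rewrite !mx_nonedge.
  rewrite !mxE_ix tt' ?(ix_lt e_sym)// ixC ix_notin// e_sym//.
have neq u : u \in vtx L -> (u == v) = false.
  by move=> uL; apply: contraNF vL => /eqP <-.
rewrite mxE !neq//= !rowv (mx_sym _ v) rowv.
have [eij|eij] := boolP (e i j).
  pose f i j := - (mx t i v * mx t j v / mx t v v).
  rewrite (mx_shift e_sym (f := f))// => k l.
  by rewrite /f [mx t k v * _]mulrC.
rewrite !(mx_nonedge e_sym _ eij)//; apply/eqP; rewrite sub0r oppr_eq0.
(* No fill-in: if both entries were nonzero, i and j would lie in the complete set N and be
   adjacent. *)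
suff : (mx t i v == 0) || (mx t j v == 0).
  by case/orP => /eqP ->; rewrite ?mulr0 ?mul0r.
apply: contraNT eij; rewrite negb_or => /andP[iv jv].
have inN u : u \in vtx L -> mx t u v != 0 -> u \in N.
  move=> uL; rewrite NE inE uL/=.
  by apply: contraNT => euv; rewrite mx_nonedge.
have /forall_inP/(_ i (inN _ iL iv))/forall_inP/(_ j (inN _ jL jv)) := cN.
by [].
Qed.

(** [K] stands for the integral over all later coordinates, which is a constant by the time row v is
    integrated. *)
Lemma iterint_star v N a K t : v \notin N -> {in N, forall u, e v u} ->
  complete_in e N -> 0 < #|N|%:R / 2 - a + 1 -> 0 <= K ->
  iterint (ix v v :: [seq ix v u | u <- enum N])
    (fun t => (factor v N a (mx t) * K)%:E) t = (gconst (v, N, a) * K)%:E.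
Proof.
move=> vN evN cN p0 K0.
have cvN : complete_in e (v |: N).
  apply/forall_inP => i; rewrite !inE => /orP[/eqP ->|iN]; apply/forall_inP => j;
    rewrite !inE => /orP[/eqP ->|jN]; rewrite ?e_refl ?evN//.
    by rewrite e_sym evN.
  by have /forall_inP/(_ i iN)/forall_inP/(_ j jN) := cN.
have pdvN := theta_pd cvN.
have D0 := pd_dt_gt0 theta_sym (theta_pd cN).
have D1 := pd_dt_gt0 theta_sym pdvN.
have NE : [set u in enum N]%SET = N by apply/setP => i; rewrite inE mem_enum.
have d0 : 0 < dt (v |: N) theta / dt N theta by rewrite divr_gt0.
set d := _ / _ in d0.
pose h (x : R) := x `^ (- a) * ((pi * x) `^ (#|N|%:R / 2) * dt N theta `^ (- 2^-1) *
   expR (- (x * d))) * K.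
have inner t' : iterint [seq ix v u | u <- enum N]
    (fun t => (factor v N a (mx t) * K)%:E) t' =
    (if 0 < mx t' v v then h (mx t' v v) else 0)%:E.
  set x := mx t' v v.
  have xE t'' : (forall k, (k < n)%N -> k \notin [seq ix v u | u <- enum N] ->
      nth 0 t'' k = nth 0 t' k) -> mx t'' v v = x.
    move=> hk; rewrite /x !mxE_ix hk ?(ix_lt e_sym)//.
    apply/mapP => -[w]; rewrite mem_enum => wN /(ix_inj e_sym (e_refl v)).
    by case=> -[_ wv]; move: wN; rewrite ?wv (negbTE vN).
  pose G t := expR (- (x^-1 * qf (v |: N) theta (fun i => mx t i v))).
  pose c := if 0 < x then x `^ (- a) * K else 0.
  have c0 : 0 <= c by rewrite /c; case: ifP => // _; rewrite mulr_ge0 ?powR_ge0.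
  rewrite (@iterint_congr _ _ _ _ (fun t'' => (c%:E * (G t'')%:E)%E)); last first.
    move=> t'' /xE xt''; rewrite -EFinM /factor xt'' /c; congr (_%:E).
    by case: ifP => _; rewrite ?mul0r// mulrAC.
  rewrite (@iterintZl _ _ _ (fun=> c) (EFin \o G))//; last 2 first.
  - by move=> t''; rewrite lee_fin expR_ge0.
  - apply/measurable_EFinP; apply: measurableT_comp => //.
    by apply: measurable_funN; exact: measurable_funM.
  rewrite /c; case: ifPn => x0; last first.
    by rewrite mul0e.
  have := @iterint_gauss (enum N) v theta x t' theta_sym; rewrite NE => -> //.
  - by rewrite -EFinM /h -cardE; congr (_%:E); rewrite mulrAC.
  - exact: enum_uniq.
  - by rewrite mem_enum.
  - by move=> u; rewrite mem_enum; exact: evN.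
rewrite /= /int1.
set c := pi `^ (#|N|%:R / 2) * dt N theta `^ (- 2^-1) * K.
have c0 : 0 <= c by rewrite !mulr_ge0 ?powR_ge0.
transitivity (\int[mu]_x (c%:E * (if (0 < x)%R then x `^ ((#|N|%:R / 2 - a + 1) - 1) *
    expR (- (x * d)) else 0)%:E))%E.
  apply: eq_integral => x _; rewrite inner (mx_upd e_sym) eqxx e_refl/=.
  rewrite -EFinM; congr (_%:E); case: ifPn => x0; last by rewrite mulr0.
  rewrite /h /c powRM ?pi_ge0 ?(ltW x0)// addrK powRD; last by rewrite (gt_eqF x0) implybT.
  by move: (pi `^ _) => q; ring.
rewrite ge0_integralZl_EFin//; last 2 first.
- by move=> x _; rewrite lee_fin; case: ifP => // _; rewrite mulr_ge0 ?powR_ge0 ?expR_ge0.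
- apply/measurable_EFinP; apply: measurable_fun_ifT => //.
    exact: measurable_fun_ltr.
  apply: measurable_funM; first exact: measurable_powR.
  apply: measurableT_comp => //; apply: measurable_funN.
  exact: measurable_funM.
rewrite integral_Gamma_scale// -EFinM; congr (_%:E).
by rewrite /gconst /c -/d mulrAC.
Qed.

(** By induction the integral over the remaining coordinates has the same value at every base point,
    so the translation coming from [iterint_clear] leaves no trace of row v and the factors
    decouple. *)
Theorem iterint_density L t : wf L ->
  (forall q, q \in L -> 0 < #|q.1.2|%:R / 2 - q.2 + 1) ->
  iterint (ecoords L) (fun t => (density L (mx t))%:E) t =
  (\prod_(q <- L) gconst q)%:E.
Proof.
elim: L t => [|[[v N] a] L IHL] t wfL qL; first by rewrite big_nil.
have [vL NE cN] : [/\ v \notin vtx L, N = [set u in vtx L | e u v]%SET,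
  complete_in e N & wf L] := wfL => wfL'.
have gc0 (q : 'I_r * {set 'I_r} * R) : 0 <= gconst q.
  by case: q => -[w M] b; rewrite /gconst !mulr_ge0 ?powR_ge0 ?Gamma_ge0.
have {}IHL t' : iterint (ecoords L) (fun t => (density L (mx t))%:E) t' =
    (\prod_(q <- L) gconst q)%:E.
  by apply: IHL => // q qL'; apply: qL; rewrite inE qL' orbT.
rewrite [ecoords _]/= -cat_cons iterint_cat big_cons.
rewrite -(@iterint_star v N a _ t); first last.
- by apply: prodr_ge0.
- exact: (qL _ (mem_head _ _)).
- by [].
- by move=> u; rewrite NE inE e_sym => /andP[].
- by rewrite NE inE (negbTE vL).
apply: eq_iterint => t' /=.
have factor_inv t1 k x : k \in ecoords L ->
    factor v N a (mx (upd t1 k x)) = factor v N a (mx t1).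
  move=> kL; rewrite /factor.
  have rowv i : mx (upd t1 k x) i v = mx t1 i v.
    rewrite (mx_upd e_sym); case: ifPn => // /andP[/eqP ik eiv].
    by move: kL; rewrite -ik ixC (negbTE (ix_notin _ _ _))// e_sym.
  rewrite rowv; case: ifP => // _; congr (_ * expR (- (_ * _))).
  by apply: eq_bigr => i _; apply: eq_bigr => j _; rewrite !rowv.
have mclear : measurable_fun setT (fun t => (density L (clear v (mx t)))%:E).
  apply/measurable_EFinP/measurable_density/measurable_clear => i j.
  exact: measurable_mx.
rewrite (@iterintZl _ _ _ (fun t => factor v N a (mx t))
  (fun t => (density L (clear v (mx t)))%:E))//.
- by rewrite (iterint_clear _ wfL) IHL.
- by move=> t1; rewrite lee_fin density_ge0.
- by move=> t1; exact: factor_ge0.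
Qed.

End Elimination.

(** * From products of pivots to integrals over P_G *)

Section ConeIntegral.
Variables (R : realType) (r : nat) (e : rel 'I_r).
Hypotheses (e_refl : reflexive e) (e_sym : symmetric e).
Local Notation RT := (measurableTypeR R).
Local Notation n := #|edge_coords e|.
Local Notation mx := (@mx_of_coords R r e).
Local Notation elim := (seq ('I_r * {set 'I_r} * R)).
Implicit Types (L : elim) (v : 'I_r) (N : {set 'I_r}) (y X : 'M[R]_r).

Variable theta : 'M[R]_r.
Hypothesis theta_sym : theta^T = theta.
Hypothesis theta_pd : forall C : {set 'I_r}, complete_in e C -> pd C theta.

Local Notation density := (density theta).
Local Notation wf := (@wf R r e).
Local Notation vset L := [set u in vtx L]%SET.

Definition edges_on (C : {set 'I_r}) y : Prop :=
  {in C &, forall i j, ~~ e i j -> y i j = 0}.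

Definition cratio X (q : 'I_r * {set 'I_r} * R) : R :=
  (dt (q.1.1 |: q.1.2) X / dt q.1.2 X) `^ q.2.

Lemma wf_complete L q : wf L -> q \in L ->
  complete_in e q.1.2 /\ complete_in e (q.1.1 |: q.1.2).
Proof.
elim: L => //= -[[v N] a] L IHL [vL NE cN wfL].
rewrite inE => /orP[/eqP ->|]; last exact: IHL.
split=> //=; apply/forall_inP => i; rewrite !inE => /orP[/eqP ->|iN];
    apply/forall_inP => j; rewrite !inE => /orP[/eqP ->|jN]; rewrite ?e_refl//.
- by move: jN; rewrite NE inE e_sym => /andP[].
- by move: iN; rewrite NE inE => /andP[].
- by have /forall_inP/(_ i iN)/forall_inP/(_ j jN) := cN.
Qed.

(** Absence of fill-in again, now for an abstract sparse matrix: completeness of N makes every new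
    nonzero entry an edge. *)
Lemma edges_on_clear v N a L y : wf ((v, N, a) :: L) -> y^T = y ->
  edges_on (vset ((v, N, a) :: L)) y -> edges_on (vset L) (clear v y).
Proof.
move=> wfL ys ye; have [vL NE cN _] := wfL => i j; rewrite !inE => iL jL eij.
have yE k l : y k l = y l k by rewrite -[in LHS]ys mxE.
have inE' u : u \in vtx L -> u \in vset ((v, N, a) :: L) by rewrite !inE => ->; rewrite orbT.
have vin : v \in vset ((v, N, a) :: L) by rewrite !inE eqxx.
have inN u : u \in vtx L -> y u v != 0 -> u \in N.
  move=> uL; rewrite NE inE uL/=; apply: contraNT => euv.
  by rewrite ye// inE'.
rewrite mxE; case: ifP => // _; rewrite ye ?inE'// sub0r.
apply/eqP; rewrite oppr_eq0; apply: contraNT eij => h.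
have [iv jv] : y i v != 0 /\ y j v != 0.
  by split; apply: contraNneq h => h; rewrite ?(yE v j) h ?mulr0 ?mul0r.
by have /forall_inP/(_ i (inN _ iL iv))/forall_inP/(_ j (inN _ jL jv)) := cN.
Qed.

Lemma vset_cons v N a L : wf ((v, N, a) :: L) ->
  vset ((v, N, a) :: L) :\ v = vset L.
Proof.
move=> [vL _ _ _]; apply/setP => i; rewrite !inE.
by have [->|] := eqVneq i v => //=; rewrite (negbTE vL).
Qed.

Lemma density_eq0 L y : wf L -> y^T = y -> ~ pd (vset L) y -> density L y = 0.
Proof.
elim: L y => [|[[v N] a] L IHL] y wfL ys npd.
  by exfalso; apply: npd => u [i]; rewrite !inE.
rewrite /=; have vin : v \in vset ((v, N, a) :: L) by rewrite !inE eqxx.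
have := contra_not (pd_clear ys vin).2 npd; rewrite (vset_cons wfL) => /not_andP[y0|npd'].
  by rewrite /factor; case: ifP => // ; rewrite mul0r.
rewrite IHL ?mulr0//; last exact: clear_tr.
by case: wfL.
Qed.

(** y is the sum of [clear v y] and the rank-one matrix built on column v, whose support lies in v
    |: N by sparsity. *)
Lemma pairing_clear v N a L y : wf ((v, N, a) :: L) -> y^T = y -> y v v != 0 ->
  edges_on (vset ((v, N, a) :: L)) y ->
  \sum_(i in vset ((v, N, a) :: L)) \sum_(j in vset ((v, N, a) :: L))
     theta i j * y i j =
  (y v v)^-1 * qf (v |: N) theta (fun i => y i v) +
  \sum_(i in vset L) \sum_(j in vset L) theta i j * clear v y i j.
Proof.
move=> wfL ys yv0 ye; have [vL NE cN _] := wfL.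
have yE k l : y k l = y l k by rewrite -[in LHS]ys mxE.
rewrite -(vset_cons wfL); set C := vset _ in ye *.
have vC : v \in C by rewrite !inE eqxx.
have clear0 i j : i \notin C :\ v -> i \in C -> clear v y i j = 0 /\ clear v y j i = 0.
  by rewrite !inE negb_and negbK => /orP[/eqP ->|/negbTE ->//]; rewrite !mxE eqxx ?orbT.
have subN : v |: N \subset C.
  apply/fintype.subsetP => u; rewrite !inE => /orP[/eqP ->|]; first by rewrite eqxx.
  by rewrite NE inE => /andP[-> _]; rewrite orbT.
have yN i : i \in C -> i \notin v |: N -> y i v = 0.
  move=> iC; rewrite !inE negb_or NE inE negb_and => /andP[iv].
  move: (iC); rewrite !inE (negbTE iv)/= => -> /= eiv.
  exact: ye.
have sub_sum (D : {set 'I_r}) (F : 'I_r -> R) : D \subset C ->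
    (forall i, i \in C -> i \notin D -> F i = 0) ->
    \sum_(i in C) F i = \sum_(i in D) F i.
  move=> DC F0; rewrite (bigID (mem D))/= [X in _ + X]big1 ?addr0; last first.
    by move=> i /andP[iC iD]; exact: F0.
  apply: eq_bigl => i; rewrite andb_idl//; exact: (fintype.subsetP DC).
transitivity (\sum_(i in C) \sum_(j in C) (y v v)^-1 * (y i v * theta i j * y j v) +
    \sum_(i in C) \sum_(j in C) theta i j * clear v y i j).
  rewrite -big_split/=; apply: eq_bigr => i iC; rewrite -big_split/=.
  apply: eq_bigr => j jC; rewrite mxE.
  have [->|iv] := eqVneq i v; first by rewrite (yE v j)/=; field.
  by have [->|jv]/= := eqVneq j v; rewrite ?(yE v j); field.
congr (_ + _).
  rewrite (sub_sum _ _ subN); last first.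
    by move=> i iC iN; rewrite big1// => j _; rewrite (yN i)// !mul0r mulr0.
  rewrite mulr_sumr; apply: eq_bigr => i _; rewrite mulr_sumr.
  by apply: (sub_sum _ _ subN) => j jC jN; rewrite (yN j)// !mulr0.
rewrite (sub_sum (C :\ v)) ?finset.subsetDl//; last first.
  by move=> i iC iD; rewrite big1// => j _; rewrite (clear0 i j _ _).1// mulr0.
apply: eq_bigr => i _; rewrite (sub_sum (C :\ v)) ?finset.subsetDl//.
by move=> j jC jD; rewrite (clear0 j i _ _).2// mulr0.
Qed.

Lemma densityE L y X : wf L -> y^T = y -> edges_on (vset L) y ->
  linv_on (vset L) X y -> (forall N, complete_in e N -> 0 < dt N X) ->
  pd (vset L) y ->
  density L y = expR (- (\sum_(i in vset L) \sum_(j in vset L) theta i j * y i j)) *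
    \prod_(q <- L) cratio X q.
Proof.
elim: L y => [|[[v N] a] L IHL] y wfL ys ye yX X0 pdy.
  by rewrite big_nil mulr1 big1 ?oppr0 ?expR0// => i; rewrite !inE.
have [vL NE cN wfL'] := wfL.
have vin : v \in vset ((v, N, a) :: L) by rewrite !inE eqxx.
have [yv0 pdy'] := (pd_clear ys vin).1 pdy; have yvn := lt0r_neq0 yv0.
have yX' := linv_on_clear vin yvn yX.
rewrite (vset_cons wfL) in pdy' yX'.
rewrite (pairing_clear wfL)// opprD expRD big_cons /= /factor yv0.
rewrite (IHL (clear v y))//; [|exact: clear_tr|exact: (edges_on_clear wfL)].
suff -> : cratio X (v, N, a) = y v v `^ (- a) by ring.
have vN : v \notin N by rewrite NE inE (negbTE vL).
(* Column v of y vanishes outside v |: N, so it solves the linear system for the submatrix of X on v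
   |: N alone; its entry at v, the pivot, is therefore |X_N| / |X_(v |: N)|. *)
have := @dt_setU1 _ _ N X v (fun i => y i v) vN => dtN.
rewrite /cratio/= -dtN; last first.
  move=> i iN; rewrite -yX//; last first.
    move: iN; rewrite !inE => /orP[->//|]; rewrite NE inE => /andP[-> _].
    by rewrite orbT.
  rewrite [RHS](bigID (mem (v |: N)))/= [X in _ = _ + X]big1 ?addr0.
    apply: eq_bigl => k; rewrite andb_idl// !inE => /orP[->//|].
    by rewrite NE inE => /andP[-> _]; rewrite orbT.
  move=> k /andP[kC]; rewrite !inE negb_or NE inE negb_and => /andP[kv].
  move: (kC); rewrite !inE (negbTE kv)/= => kL; rewrite kL/= => ekv.
  by rewrite ye ?mulr0.
have dvN : 0 < dt (v |: N) X.
  by apply: X0; have [_] := wf_complete wfL (mem_head _ _).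
have -> : dt (v |: N) X / (dt (v |: N) X * y v v) = y v v `^ (-1).
  by rewrite powR_inv1 ?ltW//; field; rewrite yvn gt_eqF.
by rewrite -powRrM mulN1r.
Qed.

Lemma PG_mx t : PG e (mx t) <-> pd [set: 'I_r]%SET (mx t).
Proof.
split=> [[_ /posdefE[]//]|pdt].
split; last by apply/posdefE; split=> //; exact: mx_tr.
by split; [exact: mx_tr|move=> i j; exact: mx_nonedge].
Qed.

Lemma phiG_dt y (N : {set 'I_r}) : complete_in e N ->
  dt N (phiG e y) = dt N (invmx y).
Proof.
move=> cN; apply: eq_dt => i j iN jN; rewrite mxE.
by have /forall_inP/(_ i iN)/forall_inP/(_ j jN) -> := cN.
Qed.

Lemma PG_dt_gt0 y (N : {set 'I_r}) : PG e y -> complete_in e N ->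
  0 < dt N (phiG e y).
Proof.
move=> [_ py] cN; rewrite phiG_dt//; have /posdefE[Xs pdX] := posdef_invmx py.
by apply: pd_dt_gt0 => //; apply: pd_subset pdX; exact: finset.subsetT.
Qed.

Lemma cratio_gt0 L y q : wf L -> PG e y -> q \in L -> 0 < cratio (phiG e y) q.
Proof.
move=> wfL Py /(wf_complete wfL)[c1 c2]; apply: powR_gt0.
by rewrite divr_gt0 ?PG_dt_gt0.
Qed.

Lemma density_PG L y : wf L -> vtx L =i 'I_r -> PG e y ->
  density L y = expR (- pairing e theta y) * \prod_(q <- L) cratio (phiG e y) q.
Proof.
move=> wfL VL Py; have [[ys ye] py] := Py.
have VT : vset L = [set: 'I_r]%SET by apply/setP => i; rewrite !inE VL.
have /posdefE[_ pdy] := py.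
have ye' : edges_on (vset L) y by move=> i j _ _; exact: ye.
have yX : linv_on (vset L) (invmx y) y.
  move=> i j _ _; have /matrixP/(_ i j) := mulVmx (posdef_unitmx py).
  by rewrite !mxE VT => <-; apply: eq_bigl => k; rewrite inE.
have X0 N : complete_in e N -> 0 < dt N (invmx y).
  by move=> cN; rewrite -phiG_dt//; exact: PG_dt_gt0.
rewrite (densityE wfL ys ye' yX X0); last by rewrite VT.
congr (expR (- _) * _).
  rewrite VT /pairing; apply: eq_big => [i|i _]; first by rewrite inE.
  rewrite [RHS]big_mkcond/=; apply: eq_big => [j|j _]; first by rewrite inE.
  by case: ifPn => // /ye ->; rewrite mulr0.
apply: eq_big_seq => q /(wf_complete wfL)[c1 c2].
by rewrite /cratio !phiG_dt.
Qed.

(** Agreement of f with [density] on P_G is enough: measurability of an integrand built from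
    determinants of an inverse is then inherited instead of being proved directly. *)
Theorem integral_PG_density L (f : 'M[R]_r -> R) : wf L -> vtx L =i 'I_r ->
  (forall q, q \in L -> 0 < #|q.1.2|%:R / 2 - q.2 + 1) ->
  (forall y, PG e y -> f y = density L y) ->
  (lebesgue_tuple R n).-integrable (@PG_coords R r e) (fun t => (f (mx t))%:E) /\
  \int[lebesgue_tuple R n]_(t in @PG_coords R r e) f (mx t) =
    \prod_(q <- L) gconst theta q.
Proof.
move=> wfL VL qL fE.
have VT : vset L = [set: 'I_r]%SET by apply/setP => i; rewrite !inE VL.
have mden : measurable_fun setT (fun t => density L (mx t)).
  by apply: measurable_density => i j; exact: measurable_mx.
have den0 t : ~ PG e (mx t) -> density L (mx t) = 0.
  move=> nP; apply: density_eq0 => //; first exact: mx_tr.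
  by rewrite VT => /PG_mx.
(* The cone is the nonvanishing set of the density, hence measurable. *)
have PGE : @PG_coords R r e = (fun t => density L (mx t)) @^-1` (~` [set 0]).
  apply/seteqP; split => t /=.
    move=> Pt; rewrite density_PG// => /eqP; rewrite mulf_eq0 gt_eqF ?expR_gt0//=.
    apply/negP; rewrite gt_eqF//; rewrite big_seq.
    by apply: prodr_gt0 => q; exact: (cratio_gt0 wfL).
  by move=> h; apply: contrapT => /den0.
have mP : measurable (@PG_coords R r e).
  rewrite PGE -[X in measurable X]setTI; apply: mden => //.
  by apply: measurableC; exact: measurable_set1.
have mf : measurable_fun (@PG_coords R r e) (fun t => (f (mx t))%:E).
  apply/measurable_EFinP; apply: (@eq_measurable_fun _ _ _ _ _ (fun t => density L (mx t))).
    by move=> t /[!inE] Pt; rewrite fE.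
  exact: measurable_funTS.
have intE : (\int[lebesgue_tuple R n]_(t in @PG_coords R r e) (f (mx t))%:E =
    (\prod_(q <- L) gconst theta q)%:E)%E.
  rewrite integral_mkcond.
  transitivity (\int[lebesgue_tuple R n]_t (density L (mx t))%:E)%E.
    apply: eq_integral => t _; rewrite patchE; case: ifPn => [|Pt].
      by rewrite inE => Pt; rewrite fE.
    by rewrite den0// => h; move: Pt; rewrite notin_setE; exact.
  rewrite (integral_lebesgue_tuple [tuple of nseq n 0]); last 2 first.
  - by move=> t; rewrite lee_fin density_ge0.
  - exact/measurable_EFinP.
  rewrite (perm_iterint _ _ (perm_ecoords _ _ wfL VL))//; last 2 first.
  - by move=> t; rewrite lee_fin density_ge0.
  - exact/measurable_EFinP.
  exact: iterint_density.
split; last by rewrite /Rintegral intE.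
apply/integrableP; split=> //.
rewrite (eq_integral (fun t => (f (mx t))%:E)); first by rewrite intE ltry.
move=> t /[!inE] Pt /=; rewrite ger0_norm// fE//; exact: density_ge0.
Qed.

End ConeIntegral.

(** * Elimination along a perfect order *)

Lemma powR_expR (R : realType) (d a : R) : 0 < d -> d `^ a = expR (a * ln d).
Proof. by move=> d0; rewrite /powR gt_eqF. Qed.

Lemma prodr_expR (R : realType) (I : Type) (s : seq I) (Q : pred I) (F : I -> R) :
  \prod_(i <- s | Q i) expR (F i) = expR (\sum_(i <- s | Q i) F i).
Proof. by rewrite (big_morph _ (@expRD R) (@expR0 R)). Qed.

Section Blocks.
Variables (R : realType) (r : nat) (e : rel 'I_r).
Hypotheses (e_refl : reflexive e) (e_sym : symmetric e).
Local Notation elim := (seq ('I_r * {set 'I_r} * R)).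
Implicit Types (L : elim) (B : seq 'I_r) (A S C : {set 'I_r}) (a p : R).

Lemma complete_inS A C : A \subset C -> complete_in e C -> complete_in e A.
Proof.
move=> /fintype.subsetP AC /forall_inP cC; apply/forall_inP => i /AC iC.
by apply/forall_inP => j /AC jC; have /forall_inP/(_ j jC) := cC _ iC.
Qed.

(* The vertices of B, eliminated while all of S and of the later part of B
   remain, with a common exponent. *)
Fixpoint block S B a : elim :=
  if B is b :: B' then (b, S :|: [set u in B']%SET, a) :: block S B' a else [::].

Lemma vtx_block S B a L : vtx (block S B a ++ L) = B ++ vtx L.
Proof. by elim: B => //= b B ->. Qed.

Lemma wf_block S B a L : wf e L -> uniq B -> {in B, forall b, b \notin vtx L} ->
  {subset S <= vtx L} -> complete_in e (S :|: [set u in B]%SET) ->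
  {in vtx L & B, forall u b, e u b -> u \in S} -> wf e (block S B a ++ L).
Proof.
move=> wfL; elim: B => //= b B IHB /andP[bB uB] BL SL cSB Se.
have sub : S :|: [set u in B]%SET \subset S :|: [set u in b :: B]%SET.
  by apply: finset.setUS; apply/fintype.subsetP => u; rewrite !inE orbC => ->.
split.
- by rewrite vtx_block mem_cat negb_or bB BL ?mem_head.
- apply/setP => u; rewrite vtx_block !inE mem_cat.
  have adj : u \in S :|: [set u in B]%SET -> e u b.
    move=> /(fintype.subsetP sub) uSB.
    have /forall_inP/(_ u uSB)/forall_inP/(_ b) := cSB.
    by apply; rewrite !inE eqxx orbT.
  apply/idP/andP => [uSB|[/orP[->|uL] ub]]; rewrite ?orbT//.
    split; last by apply: adj; rewrite !inE.
    by case/orP: uSB => [/SL ->|->//]; rewrite orbT.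
  by rewrite (Se u b)// mem_head.
- exact: complete_inS sub cSB.
- apply: IHB => //.
  + by move=> c cB; apply: BL; rewrite inE cB orbT.
  + exact: complete_inS sub cSB.
  + by move=> u c uL cB; apply: Se => //; rewrite inE cB orbT.
Qed.

(** Reduces the convergence condition on a whole block to the case N = S. *)
Lemma mem_block_card S B a q : q \in block S B a -> (#|S| <= #|q.1.2|)%N /\ q.2 = a.
Proof.
elim: B => //= b B IHB; rewrite inE => /orP[/eqP ->/=|//]; split => //.
exact/subset_leq_card/finset.subsetUl.
Qed.

Let setU_cons S b B : b |: (S :|: [set u in B]%SET) = S :|: [set u in b :: B]%SET.
Proof. by apply/setP => i; rewrite !inE orbCA. Qed.

Lemma prod_cratio_block (x : 'M[R]_r) S B a :
  (forall C, complete_in e C -> 0 < dt C x) ->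
  complete_in e (S :|: [set u in B]%SET) ->
  \prod_(q <- block S B a) cratio x q =
  expR (a * (ln (dt (S :|: [set u in B]%SET) x) - ln (dt S x))).
Proof.
move=> x0; elim: B => [|b B IHB] cSB /=.
  rewrite big_nil (_ : [set u in [::]]%SET = finset.set0); last first.
    by apply/setP => i; rewrite !inE.
  by rewrite finset.setU0 subrr mulr0 expR0.
have cSB' : complete_in e (S :|: [set u in B]%SET).
  by apply: complete_inS cSB; rewrite -setU_cons finset.subsetUr.
rewrite big_cons IHB// /cratio/= setU_cons.
rewrite powR_expR ?divr_gt0 ?x0// ln_div ?posrE ?x0//.
by rewrite -expRD; congr expR; ring.
Qed.

(** Peels off the factor j = 1. The shift by 1/2 matches what one more vertex in a block does to (c
    + 1)/2 - a. *)
Lemma mvGammaS n p : mvGamma n.+1 (p + 2^-1) =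
  pi `^ (n%:R / 2) * Gamma (p + 2^-1) * mvGamma n p.
Proof.
have recl (F : nat -> R) : \prod_(1 <= j < n.+2) F j = F 1%N * \prod_(1 <= j < n.+1) F j.+1.
  by rewrite big_nat_recl.
rewrite /mvGamma (recl (fun j => Gamma (p + 2^-1 - j.-1%:R / 2))).
have -> : p + 2^-1 - 1.-1%:R / 2 = p + 2^-1 by rewrite mul0r subr0.
have -> : \prod_(1 <= i < n.+1) Gamma (p + 2^-1 - i%:R / 2) =
    \prod_(1 <= j < n.+1) Gamma (p - j.-1%:R / 2).
  rewrite !big_add1/=; apply: eq_big_nat => j _; congr Gamma.
  by rewrite -addn1 natrD; field.
have -> : (pi : R) `^ ((n.+1 * n)%:R / 4) = pi `^ (n%:R / 2) * pi `^ ((n * n.-1)%:R / 4).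
  rewrite -powRD ?(gt_eqF (pi_gt0 R)) ?implybT//; congr (_ `^ _).
  by case: n {recl} => [|n /=]; rewrite ?mul0n ?mul0r ?addr0// !natrM -!natr1; field.
by move: (pi `^ _) (pi `^ _) => u w; ring.
Qed.

(** The minors of the intermediate sets cancel between consecutive vertices, leaving only the two
    ends of the block, while the one-dimensional Gamma factors assemble through [mvGammaS]. *)
Lemma prod_gconst_block (theta : 'M[R]_r) S B a : uniq B ->
  {in B, forall b, b \notin S} ->
  (forall C, complete_in e C -> 0 < dt C theta) ->
  complete_in e (S :|: [set u in B]%SET) ->
  let c := (#|S| + size B)%N in
  \prod_(q <- block S B a) gconst theta q =
  mvGamma_quot c #|S| ((c%:R + 1) / 2 - a) *
  expR (((#|S|%:R + 1) / 2 - a) * ln (dt S theta) +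
        (a - (c%:R + 1) / 2) * ln (dt (S :|: [set u in B]%SET) theta)).
Proof.
move=> + + th0; rewrite /mvGamma_quot addKn; have pi0 := pi_gt0 R.
elim: B => [|b B IHB] /=.
  move=> _ _ _; rewrite big_nil (_ : [set u in [::]]%SET = finset.set0); last first.
    by apply/setP => i; rewrite !inE.
  rewrite finset.setU0 !addn0 mul0n /mvGamma mul0n !mul0r powRr0 big_geq// !mul1r.
  by rewrite -[LHS]expR0; congr expR; ring.
move=> /andP[bB uB] BS cSB.
have cSB' : complete_in e (S :|: [set u in B]%SET).
  by apply: complete_inS cSB; rewrite -setU_cons finset.subsetUr.
rewrite big_cons IHB//; last by move=> u uB'; apply: BS; rewrite inE uB' orbT.
have cardN : #|S :|: [set u in B]%SET| = (#|S| + size B)%N.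
  rewrite cardsU (_ : S :&: [set u in B]%SET = finset.set0) ?cards0 ?subn0.
    by rewrite cardsE (card_uniqP uB).
  apply/setP => u; rewrite !inE; apply/negbTE/negP => /andP[uS uB'].
  by have := BS u; rewrite inE uB' orbT uS => /(_ isT).
rewrite /gconst cardN setU_cons.
set s := #|S|; set m := size B; set lS := ln (dt S theta).
set lN := ln (dt (S :|: _) theta); set lM := ln (dt _ theta).
rewrite addnS -[(s + m).+1%:R]natr1.
pose p : R := ((s + m)%:R + 1) / 2 - a.
have -> : (((s + m)%:R + 1 + 1) / 2 - a) = p + 2^-1 by rewrite /p; field.
have -> : (s + m)%:R / 2 - a + 1 = p + 2^-1 by rewrite /p; field.
rewrite mvGammaS -/p (powR_expR _ (th0 _ cSB')) -/lN.
have dM : 0 < dt (S :|: [set u in b :: B]%SET) theta by exact: th0.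
have dN : 0 < dt (S :|: [set u in B]%SET) theta by exact: th0.
rewrite (powR_expR _ (divr_gt0 dM dN)) ln_div ?posrE// -/lN -/lM.
rewrite !(powR_expR _ pi0); set q := ln pi.
set G := Gamma _; set M := mvGamma m p.
rewrite [LHS](_ : _ = G * M * expR ((s + m)%:R / 2 * q - 2^-1 * lN - (p + 2^-1) * (lM - lN) +
   (m * s)%:R / 2 * q + (((s%:R + 1) / 2 - a) * lS + (a - ((s + m)%:R + 1) / 2) * lN))).
  rewrite [RHS](_ : _ = G * M * expR ((m.+1 * s)%:R / 2 * q + m%:R / 2 * q +
    (((s%:R + 1) / 2 - a) * lS + (a - ((s + m)%:R + 1 + 1) / 2) * lM))).
    by congr (_ * expR _); rewrite /p !natrD !natrM -natr1; field.
  by rewrite !expRD; ring.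
by rewrite !expRD -!mulNr; ring.
Qed.

End Blocks.

(** * Combinatorics of perfect orders *)

Section PerfectOrder.
Variables (r : nat) (e : rel 'I_r).
Hypotheses (e_refl : reflexive e) (e_sym : symmetric e).
Variable P : seq {set 'I_r}.
Hypothesis P_perfect : perfect_order e P.
Local Notation k := (size P).
Local Notation Cl := (nth_clique P).
Local Notation Sp := (sep P).
Implicit Types (u v : 'I_r) (i j m n : nat).

Lemma mem_bigcup_nat (F : nat -> {set 'I_r}) m n u :
  u \in (\bigcup_(m <= i < n) F i)%SET <-> exists2 i, (m <= i < n)%N & u \in F i.
Proof.
suff -> : (u \in (\bigcup_(m <= i < n) F i)%SET) <->
    exists2 i, i \in index_iota m n & u \in F i.
  by split=> -[i]; exists i; rewrite // ?mem_index_iota// -mem_index_iota.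
elim: (index_iota m n) => [|i s IHs].
  by rewrite big_nil inE; split=> // -[].
rewrite big_cons inE; split.
  case/orP => [ui|/IHs[j js uj]]; first by exists i; rewrite ?mem_head.
  by exists j; rewrite // inE js orbT.
move=> [j]; rewrite inE => /orP[/eqP -> ->//|js uj].
by apply/orP; right; apply/IHs; exists j.
Qed.

Lemma nth_clique_complete j : (1 <= j <= k)%N -> complete_in e (Cl j).
Proof.
move=> /andP[j1 jk]; have [_ PC _] := P_perfect.
have : Cl j \in P by apply: mem_nth; rewrite prednK.
by rewrite PC inE => /maxsetp.
Qed.

Lemma sep_sub j : Sp j \subset Cl j.
Proof. exact: finset.subsetIr. Qed.

Lemma sep_complete j : (2 <= j <= k)%N -> complete_in e (Sp j).
Proof.
move=> /andP[j2 jk]; apply: complete_inS (sep_sub j) _.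
by apply: nth_clique_complete; rewrite (ltnW j2).
Qed.

Lemma edge_in_clique u v : e u v ->
  exists2 i, (1 <= i <= k)%N & u \in Cl i /\ v \in Cl i.
Proof.
move=> uv; have [_ PC _] := P_perfect.
have c2 : complete_in e [set u; v]%SET.
  apply/forall_inP => i; rewrite !inE => /orP[]/eqP ->; apply/forall_inP => j;
    by rewrite !inE => /orP[]/eqP ->; rewrite ?e_refl// e_sym.
have [A maxA /fintype.subsetP uvA] := maxset_exists c2.
have AP : A \in P by rewrite PC inE.
exists (index A P).+1; first by rewrite /= index_mem.
by rewrite /nth_clique /= nth_index// !uvA ?inE ?eqxx ?orbT.
Qed.

(** Descent on a clique C_i containing both u and b. If i > j, both lie in S_i, hence in an earlier
    clique; i < j is excluded as b is new in C_j; so i = j is reached. *)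
Lemma sep_neighbour j u b : (2 <= j <= k)%N ->
  u \in (\bigcup_(1 <= i < j) Cl i)%SET -> b \in Cl j -> b \notin Sp j ->
  e u b -> u \in Sp j.
Proof.
move=> /andP[j2 jk] uV bC bS ub.
have bV : b \notin (\bigcup_(1 <= i < j) Cl i)%SET.
  by apply: contra bS => bV; rewrite inE bV.
rewrite inE uV/=; have [i + [ui bi]] := edge_in_clique ub.
have [m] := ubnP i; elim: m i ui bi => // m IHm i ui bi im /andP[i1 ik].
have [ij|ji|<-//] := ltngtP i j.
  by case/negP: bV; apply/mem_bigcup_nat; exists i; rewrite ?i1.
have [_ _ Psep] := P_perfect.
have i2 : (2 <= i <= k)%N by rewrite ik andbT (leq_trans j2)// ltnW.
have [i' /andP[i'1 i'i] /fintype.subsetP Si] := Psep i i2.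
have inV w : w \in (\bigcup_(1 <= i < j) Cl i)%SET \/ w \in Cl j -> w \in Cl i -> w \in Cl i'.
  move=> wV wi; apply: Si; rewrite inE wi andbT; apply/mem_bigcup_nat.
  case: wV => [/mem_bigcup_nat[l /andP[l1 lj] wl]|wj].
    by exists l; rewrite // l1 (ltn_trans lj).
  by exists j; rewrite // ji andbT (leq_trans _ j2).
apply: (IHm i'); [by apply: inV => //; left|by apply: inV => //; right| |].
  by rewrite (leq_trans i'i).
by rewrite i'1 (leq_trans (ltnW i'i)).
Qed.

Lemma cliques_cover u : u \in (\bigcup_(1 <= i < k.+1) Cl i)%SET.
Proof.
have [i /andP[i1 ik] [ui _]] := edge_in_clique (e_refl u).
by apply/mem_bigcup_nat; exists i; rewrite ?i1.
Qed.

(** Guarantees that S_2 is a genuine separator. *)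
Lemma noncomplete_size : ~~ complete_in e [set: 'I_r]%SET -> (1 < k)%N.
Proof.
apply: contraR; rewrite -leqNgt => k1; apply/forall_inP => u _.
apply/forall_inP => v _.
have in1 w : w \in Cl 1 /\ (1 <= 1 <= k)%N.
  have /mem_bigcup_nat[i /andP[i1 ik] wi] := cliques_cover w.
  have i1' : i = 1%N.
    by apply/eqP; rewrite eqn_leq i1 andbT (leq_trans _ k1).
  by rewrite i1' in wi ik; rewrite wi.
have /forall_inP/(_ u (in1 u).1)/forall_inP/(_ v (in1 v).1) :=
  nth_clique_complete (in1 u).2.
by [].
Qed.

Lemma sum_cliques (R : realType) (f : {set 'I_r} -> R) :
  \sum_(C in cliques e) f C = \sum_(1 <= j < k.+1) f (Cl j).
Proof.
have [uP PC _] := P_perfect.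
rewrite big_add1/= -(big_nth finset.set0 predT f) big_uniq//=.
by apply: eq_bigl => C; rewrite -PC.
Qed.

Lemma sum_seps (R : realType) (f : nat -> R) :
  \sum_(2 <= j < k.+1) f j =
  \sum_(S in seps P) \sum_(2 <= j < k.+1 | Sp j == S) f j.
Proof.
rewrite [LHS]big_nat (partition_big Sp (mem (seps P)))/=; last first.
  by move=> j jk; rewrite inE; apply: map_f; rewrite mem_index_iota.
apply: eq_bigr => S _; rewrite [RHS]big_nat_cond; exact: eq_bigl.
Qed.

Lemma sum_sep_mult (R : realType) (f : {set 'I_r} -> R) :
  \sum_(S in seps P) (sep_mult P S)%:R * f S = \sum_(2 <= j < k.+1) f (Sp j).
Proof.
rewrite sum_seps; apply: eq_bigr => S _.
rewrite /sep_mult natr_sum mulr_suml; apply: eq_bigr => j /eqP ->.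
by rewrite mul1r.
Qed.

(** * Exponents and constants attached to (alpha, beta) *)

Section Weights.
Variable R : realType.
Hypothesis k_gt1 : (1 < k)%N.
Variables alpha beta : {set 'I_r} -> R.
Hypothesis abP : BP P (alpha, beta).
Local Notation c j := (#|Cl j|%:R : R).
Local Notation s j := (#|Sp j|%:R : R).
Local Notation g2 := (gamma2 P alpha beta).

(** The total power of |x_(C_j)|: the weight from H_G plus the one from nu_G. *)
Let A j : R := alpha (Cl j) + (c j + 1) / 2.

(* Condition (1) of B_P says that the exponents of |x_S| cancel when S <> S_2. *)
Lemma BP_sum (l : {set 'I_r} -> R) :
  \sum_(2 <= j < k.+1) (alpha (Cl j) - beta (Sp j) + (c j - s j) / 2) * l (Sp j) =
  g2 * l (Sp 2).
Proof.
case: abP => /= cond _ _ _; rewrite sum_seps (bigD1 (Sp 2))/=; last first.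
  by rewrite inE; apply: map_f; rewrite mem_index_iota leqnn.
rewrite [X in _ + X]big1 ?addr0.
  by rewrite /gamma2 mulr_suml; apply: eq_bigr => j /eqP ->.
move=> S /andP[SP S2]; have := cond S SP S2; rewrite /sep_mult natr_sum mulr_suml.
rewrite -sumrB => h; transitivity (0 * l S); last exact: mul0r.
by rewrite -[in RHS]h mulr_suml; apply: eq_bigr => j /eqP ->; ring.
Qed.

Local Notation elim := (seq ('I_r * {set 'I_r} * R)).

(* perfect_elim m eliminates C_(m+1) \ S_(m+1), ..., C_2 \ S_2, C_1 \ S_2 and S_2,
   in this order. *)
Fixpoint perfect_elim m : elim :=
  if m is m'.+1 then
    block (Sp m.+1) (enum (Cl m.+1 :\: Sp m.+1)) (A m.+1) ++ perfect_elim m'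
  else block (Sp 2) (enum (Cl 1 :\: Sp 2)) (A 1) ++
       block finset.set0 (enum (Sp 2)) (A 1 + g2).

Let setU_sep j (C : {set 'I_r}) : Sp j \subset C ->
  Sp j :|: [set u in enum (C :\: Sp j)]%SET = C.
Proof.
move=> SC; rewrite -[RHS](finset.setID C (Sp j)) (finset.setIidPr SC).
by congr (_ :|: _); apply/setP => u; rewrite inE mem_enum.
Qed.

Let sep2_sub1 : Sp 2 \subset Cl 1.
Proof. by rewrite /sep big_nat1 finset.subsetIl. Qed.

Let k1 : (1 <= 1 <= k)%N.
Proof. exact: ltnW. Qed.

Let set0U_sep2 : finset.set0 :|: [set u in enum (Sp 2)]%SET = Sp 2.
Proof. by rewrite finset.set0U; apply/setP => u; rewrite inE mem_enum. Qed.

Lemma wf_perfect_elim m : (m < k)%N -> wf e (perfect_elim m) /\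
  vtx (perfect_elim m) =i (\bigcup_(1 <= i < m.+2) Cl i)%SET.
Proof.
elim: m => [_|m IHm mk] /=.
  have vtx2 : vtx (block finset.set0 (enum (Sp 2)) (A 1 + g2)) = enum (Sp 2).
    by rewrite -[X in vtx X]cats0 vtx_block cats0.
  split; last first.
    move=> u; rewrite big_nat1 vtx_block mem_cat vtx2 !mem_enum.
    rewrite -[in RHS](finset.setID (Cl 1) (Sp 2)) (finset.setIidPr sep2_sub1).
    by rewrite finset.in_setU orbC.
  apply: wf_block => //.
  - rewrite -[block _ _ _]cats0; apply: wf_block => //; first exact: enum_uniq.
      by move=> u; rewrite inE.
    by rewrite set0U_sep2; apply: sep_complete; rewrite leqnn.
  - exact: enum_uniq.
  - by move=> b; rewrite vtx2 !mem_enum => /setDP[].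
  - by move=> u uS; rewrite vtx2 mem_enum.
  - by rewrite setU_sep//; exact: nth_clique_complete.
  - by move=> u b; rewrite vtx2 mem_enum.
have [wfm vm] := IHm (ltnW mk); split; last first.
  move=> u; rewrite vtx_block mem_cat vm mem_enum [in RHS]big_nat_recr//=.
  rewrite finset.in_setU finset.in_setD finset.in_setI negb_and orbC.
  by case: (u \in (\bigcup_(1 <= i < m.+2) _)%SET); case: (u \in Cl m.+2).
have mk2 : (2 <= m.+2 <= k)%N by [].
apply: wf_block => //.
- exact: enum_uniq.
- by move=> b; rewrite mem_enum vm => /setDP[bC]; apply: contra => bV; rewrite inE bV.
- by move=> u; rewrite vm inE => /andP[].
- by rewrite setU_sep ?sep_sub//; exact: nth_clique_complete.
- move=> u b; rewrite vm mem_enum => uV /setDP[bC bS] ub.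
  exact: (sep_neighbour mk2 uV bC bS ub).
Qed.

(** For N = S_j the inequality is condition (2), with S_2 in the role of the separator of C_1. For
    the block of S_2 the worst case is N empty, and condition (3) applies. *)
Lemma perfect_elim_cond m (q : 'I_r * {set 'I_r} * R) :
  (m < k)%N -> q \in perfect_elim m ->
  0 < #|q.1.2|%:R / 2 - q.2 + 1.
Proof.
case: abP => /= _ cond2 cond1 cond3.
have step (S : {set 'I_r}) (a : R) : 0 < #|S|%:R / 2 - a + 1 ->
    forall B, q \in block S B a -> 0 < #|q.1.2|%:R / 2 - q.2 + 1.
  move=> h B /mem_block_card[SN ->]; apply: lt_le_trans h _.
  by rewrite lerD2r lerD2r ler_pM2r// ler_nat.
elim: m => [_|m IHm mk] /=; rewrite mem_cat => /orP[].
- by apply: step; rewrite /A; lra.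
- apply: step; rewrite cards0 /A.
  have : 0 <= s 2 by []. lra.
- apply: step; have := cond2 m.+2; rewrite mk => /(_ isT); rewrite /A; lra.
- by apply: IHm; exact: ltnW.
Qed.

Lemma big_perfect_elim (F : 'I_r * {set 'I_r} * R -> R) m :
  \prod_(q <- perfect_elim m) F q =
  (\prod_(2 <= j < m.+2) \prod_(q <- block (Sp j) (enum (Cl j :\: Sp j)) (A j)) F q) *
  (\prod_(q <- block (Sp 2) (enum (Cl 1 :\: Sp 2)) (A 1)) F q *
   \prod_(q <- block finset.set0 (enum (Sp 2)) (A 1 + g2)) F q).
Proof.
elim: m => [|m IHm] /=; first by rewrite big_cat/= big_geq// mul1r.
by rewrite big_cat/= IHm [in RHS]big_nat_recr//= mulrA [X in X * _ = _]mulrC.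
Qed.

Section minors.
Variable x : 'M[R]_r.
Hypothesis x0 : forall C, complete_in e C -> 0 < dt C x.
Let l (C : {set 'I_r}) := ln (dt C x).

Let l0 : l finset.set0 = 0.
Proof. by rewrite /l dt_set0 ln1. Qed.

Lemma HG_expR : HG e P alpha beta x =
  expR (\sum_(1 <= j < k.+1) alpha (Cl j) * l (Cl j) -
        \sum_(2 <= j < k.+1) beta (Sp j) * l (Sp j)).
Proof.
rewrite /HG expRD expRN; congr (_ * _^-1).
  rewrite (eq_bigr (fun C => expR (alpha C * l C))); last first.
    move=> C; rewrite inE => /maxsetp cC.
    by rewrite det_princ_mx powR_expR// x0.
  by rewrite prodr_expR sum_cliques.
rewrite (eq_bigr (fun S => expR ((sep_mult P S)%:R * (beta S * l S)))); last first.
  move=> S; rewrite inE => /mapP[j]; rewrite mem_index_iota => jk ->.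
  by rewrite det_princ_mx powR_expR ?mulrA// x0// sep_complete.
by rewrite prodr_expR (sum_sep_mult (fun S => beta S * l S)).
Qed.

Lemma HG_gt0 : 0 < HG e P alpha beta x.
Proof. by rewrite HG_expR expR_gt0. Qed.

Let ratio_block j (C : {set 'I_r}) a : Sp j \subset C -> complete_in e C ->
  \prod_(q <- block (Sp j) (enum (C :\: Sp j)) a) cratio x q =
  expR (a * (l C - l (Sp j))).
Proof.
by move=> SC cC; rewrite (prod_cratio_block _ x0) setU_sep.
Qed.

(** In logarithms, the blocks produce the wrong coefficient at each separator; by [BP_sum] the total
    error is [g2] times the logarithm of |x_(S_2)|, which the extra exponent [g2] on the block of
    S_2 restores. *)
Lemma prod_cratio_perfect_elim :
  \prod_(q <- perfect_elim k.-1) cratio x q =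
  HG e P alpha beta x *
  (\prod_(C in cliques e) (\det (princ_mx C x)) `^ ((#|C|%:R + 1) / 2) *
   \prod_(S in seps P)
     (\det (princ_mx S x)) `^ (- ((sep_mult P S)%:R * (#|S|%:R + 1) / 2))).
Proof.
have -> : \prod_(C in cliques e) (\det (princ_mx C x)) `^ ((#|C|%:R + 1) / 2) =
    expR (\sum_(1 <= j < k.+1) (c j + 1) / 2 * l (Cl j)).
  rewrite -(sum_cliques (fun C => (#|C|%:R + 1) / 2 * l C)) -prodr_expR.
  apply: eq_bigr => C; rewrite inE => /maxsetp cC.
  by rewrite det_princ_mx powR_expR// x0.
have -> : \prod_(S in seps P)
     (\det (princ_mx S x)) `^ (- ((sep_mult P S)%:R * (#|S|%:R + 1) / 2)) =
    expR (- \sum_(2 <= j < k.+1) (s j + 1) / 2 * l (Sp j)).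
  rewrite -(sum_sep_mult (fun S => (#|S|%:R + 1) / 2 * l S)) -sumrN -prodr_expR.
  apply: eq_bigr => S; rewrite inE => /mapP[j]; rewrite mem_index_iota => jk ->.
  rewrite det_princ_mx powR_expR; last by rewrite x0// sep_complete.
  by congr expR; rewrite /l; ring.
rewrite HG_expR -!expRD big_perfect_elim prednK ?(ltnW k_gt1)//.
rewrite (eq_big_nat _ _ (F2 := fun j => expR (A j * (l (Cl j) - l (Sp j))))); last first.
  move=> j /andP[j2 jk]; rewrite ratio_block ?sep_sub// nth_clique_complete//.
  by rewrite (ltnW j2).
rewrite ratio_block ?nth_clique_complete// (prod_cratio_block _ x0); last first.
  by rewrite set0U_sep2 sep_complete// leqnn.
rewrite set0U_sep2 -/(l _) -/(l _) l0 subr0 prodr_expR -!expRD; congr expR.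
have -> : \sum_(2 <= j < k.+1) A j * (l (Cl j) - l (Sp j)) =
    \sum_(2 <= j < k.+1) alpha (Cl j) * l (Cl j) -
    \sum_(2 <= j < k.+1) beta (Sp j) * l (Sp j) +
    (\sum_(2 <= j < k.+1) (c j + 1) / 2 * l (Cl j) -
     \sum_(2 <= j < k.+1) (s j + 1) / 2 * l (Sp j)) - g2 * l (Sp 2).
  rewrite -BP_sum -!sumrB -big_split -sumrB; apply: eq_bigr => j _.
  by rewrite /A/=; field.
by rewrite !(@big_ltn _ _ _ 1) ?(ltnW k_gt1)// /A; field.
Qed.

Let gconst_block j (C : {set 'I_r}) a : Sp j \subset C -> complete_in e C ->
  \prod_(q <- block (Sp j) (enum (C :\: Sp j)) a) gconst x q =
  mvGamma_quot #|C| #|Sp j| ((#|C|%:R + 1) / 2 - a) *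
  expR (((s j + 1) / 2 - a) * l (Sp j) + (a - (#|C|%:R + 1) / 2) * l C).
Proof.
move=> SC cC; rewrite (@prod_gconst_block _ _ e)//.
- by rewrite -cardE cardsD (finset.setIidPr SC) subnKC ?subset_leq_card// setU_sep.
- exact: enum_uniq.
- by move=> b; rewrite mem_enum => /setDP[].
- by rewrite setU_sep.
Qed.

(** The cancellation that recovers H_G in the integrand occurs a second time, now in the powers of
    the minors of theta. *)
Lemma prod_gconst_perfect_elim :
  \prod_(q <- perfect_elim k.-1) gconst x q =
  GammaII P alpha beta * HG e P alpha beta x.
Proof.
rewrite big_perfect_elim prednK ?(ltnW k_gt1)//.
rewrite (eq_big_nat _ _ (F2 := fun j => mvGamma_quot #|Cl j| #|Sp j| (- alpha (Cl j)) *
    expR (((s j + 1) / 2 - A j) * l (Sp j) + alpha (Cl j) * l (Cl j)))); last first.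
  move=> j /andP[j2 jk]; rewrite gconst_block ?sep_sub//; last first.
    by rewrite nth_clique_complete// (ltnW j2).
  have -> : (c j + 1) / 2 - A j = - alpha (Cl j) by rewrite /A; field.
  by have -> : A j - (c j + 1) / 2 = alpha (Cl j) by rewrite /A; field.
rewrite gconst_block ?nth_clique_complete// (@prod_gconst_block _ _ e)//; first last.
- by rewrite set0U_sep2 sep_complete// leqnn.
- by move=> b; rewrite !inE.
- exact: enum_uniq.
rewrite set0U_sep2 -/(l _) -/(l _) l0 cards0 add0n -cardE big_split/= prodr_expR.
(* The block of S_2 is built over the empty set, so its quotient is the plain Gamma function of S_2,
   the first factor of [GammaII]. *)
have quot0 m p : mvGamma_quot m 0 p = mvGamma m p.
  by rewrite /mvGamma_quot muln0 mul0r powRr0 mul1r subn0.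
rewrite quot0 /GammaII HG_expR.
have -> : (c 1 + 1) / 2 - A 1 = - alpha (Cl 1) by rewrite /A; field.
have -> : (s 2 + 1) / 2 - (A 1 + g2) = - alpha (Cl 1) - (c 1 - s 2) / 2 - g2.
  by rewrite /A; field.
set M1 := mvGamma _ _; set M2 := mvGamma_quot _ _ _; set M3 := \prod_(2 <= j < _) _.
rewrite [LHS](_ : _ = M1 * M2 * M3 * expR (
   \sum_(2 <= j < k.+1) (((s j + 1) / 2 - A j) * l (Sp j) + alpha (Cl j) * l (Cl j)) +
   (((s 2 + 1) / 2 - A 1) * l (Sp 2) + (A 1 - (c 1 + 1) / 2) * l (Cl 1)) +
   (A 1 + g2 - (s 2 + 1) / 2) * l (Sp 2))); last first.
  by rewrite mulr0 add0r !expRD; ring.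
congr (_ * expR _).
have -> : \sum_(2 <= j < k.+1) (((s j + 1) / 2 - A j) * l (Sp j) + alpha (Cl j) * l (Cl j)) =
    \sum_(2 <= j < k.+1) alpha (Cl j) * l (Cl j) -
    \sum_(2 <= j < k.+1) beta (Sp j) * l (Sp j) - g2 * l (Sp 2).
  rewrite -BP_sum -!sumrB; apply: eq_bigr => j _.
  by rewrite /A; field.
by rewrite (@big_ltn _ _ _ 1) ?(ltnW k_gt1)// /A; field.
Qed.

End minors.

End Weights.

End PerfectOrder.

Theorem theorem3p4 (R : realType) (r : nat) (e : rel 'I_r)
  (e_refl : reflexive e) (e_sym : symmetric e)
  (e_dec : decomposable e)
  (e_noncomplete : ~~ complete_in e [set: 'I_r]%SET)
  (P : seq {set 'I_r}) (P_perfect : perfect_order e P) :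
  BP (R := R) P `<=` calB e P /\
  (forall (theta : 'M[R]_r) (alpha beta : {set 'I_r} -> R),
     QG e theta -> BP P (alpha, beta) ->
     J_converges e P alpha beta theta /\
     J e P alpha beta theta = GammaII P alpha beta * HG e P alpha beta theta).
Proof.
have k_gt1 := noncomplete_size e_refl e_sym P_perfect e_noncomplete.
have theta_pd (theta : 'M[R]_r) : QG e theta ->
    forall C : {set 'I_r}, complete_in e C -> pd C theta.
  (* Positivity is given on cliques only; every complete set extends to one. *)
  move=> [_ Qth] C cC; have [D maxD CD] := maxset_exists cC.
  by apply: pd_subset CD _; apply/posdef_princ_mx/Qth; rewrite inE.
have theta_gt0 (theta : 'M[R]_r) : QG e theta ->
    forall C : {set 'I_r}, complete_in e C -> 0 < dt C theta.
  by move=> Qth C cC; case: (Qth) => -[ths _] _; apply: pd_dt_gt0 => //; exact: theta_pd.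
have main theta alpha beta : QG e theta -> BP (R := R) P (alpha, beta) ->
    J_converges e P alpha beta theta /\
    J e P alpha beta theta = GammaII P alpha beta * HG e P alpha beta theta.
  move=> Qth abP; have [[ths _] _] := Qth.
  have k0 : ((size P).-1 < size P)%N by rewrite prednK ?(ltnW k_gt1).
  have [wfL VL] := wf_perfect_elim e_refl e_sym P_perfect k_gt1 alpha beta k0.
  rewrite prednK ?(ltnW k_gt1)// in VL.
  have VT : vtx (perfect_elim P alpha beta (size P).-1) =i 'I_r.
    by move=> u; rewrite VL (cliques_cover e_refl e_sym P_perfect).
  rewrite -(prod_gconst_perfect_elim P_perfect k_gt1 abP (theta_gt0 _ Qth)).
  apply: (integral_PG_density e_refl e_sym ths (theta_pd _ Qth) wfL VT) => [q|y Py].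
    exact: (perfect_elim_cond abP k0).
  rewrite (density_PG e_refl e_sym theta wfL VT Py).
  rewrite (prod_cratio_perfect_elim P_perfect k_gt1 abP); last first.
    by move=> C; exact: PG_dt_gt0.
  by rewrite /J_integrand /nuG_density -mulrA.
split; last exact: main.
move=> [alpha beta] abP; split=> [theta Qth|]; first exact: (main _ _ _ Qth abP).1.
exists (GammaII P alpha beta) => theta Qth; rewrite (main _ _ _ Qth abP).2 mulfK//.
by rewrite gt_eqF// (HG_gt0 P_perfect _ _ (theta_gt0 _ Qth)).
Qed.
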